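(* Let $2\le p<3$, $T>0$, let $E$ be a Banach space, let $V$ be a $\mathcal{C}^2_b$ vector field on $E$, let $\mathrm F=(V_1,\dots,V_\ell)$ be a collection of $\mathcal{C}^3_b$ vector fields on $E$, and let $\mathbf X=(X,\mathbb X)$ be a weak geometric Hölder $p$-rough path over $\mathbb{R}^\ell$ on $[0,T]$. Then the rough differential equation on flows $$d\varphi=V\,dt+\mathrm F^{\otimes}\,\mathbf X(dt)$$ has a unique solution flow $(\varphi_{ts})_{0\le s\le t\le T}$. It takes values in the space of uniformly Lipschitz continuous homeomorphisms of $E$ with uniformly Lipschitz continuous inverses, and it depends continuously on $\mathbf X$.
   Context: Repeated indices are summed. $\mathcal{C}^k_b$ means $k$ times continuously differentiable, bounded, with bounded derivatives up to order $k$. $[V_j,V_k]=V_jV_k-V_kV_j$ is the Lie bracket of vector fields, viewed as first order differential operators. For $2\le p<3$, a Hölder $p$-rough path over $\mathbb{R}^\ell$ on $[0,T]$ is a pair $\mathbf X=(X,\mathbb X)$ with $X_{ts}\in\mathbb{R}^\ell$, $\mathbb X_{ts}\in(\mathbb{R}^\ell)^{\otimes2}$ for $0\le s\le t\le T$, such that $X_{ts}=X_{tu}+X_{us}$ and $\mathbb X_{ts}=\mathbb X_{tu}+X_{us}\otimes X_{tu}+\mathbb X_{us}$ for $s\le u\le t$, and $|X_{ts}|\le C|t-s|^{1/p}$, $|\mathbb X_{ts}|\le C|t-s|^{2/p}$ for some $C$. It is weak geometric if the symmetric part of $\mathbb X_{ts}$ equals $\frac12X_{ts}\otimes X_{ts}$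 for all $s\le t$. The distance between two such rough paths is $d(\mathbf X,\mathbf Y)=\max\big\{\sup_{s<t}\frac{|X_{ts}-Y_{ts}|}{|t-s|^{1/p}},\sup_{s<t}\frac{|\mathbb X_{ts}-\mathbb Y_{ts}|}{|t-s|^{2/p}}\big\}$. A flow on $E$ is a family $(\varphi_{ts})_{0\le s\le t\le T}$ of maps $E\to E$ with $\varphi_{tt}=\mathrm{Id}$ and $\varphi_{ts}=\varphi_{tu}\circ\varphi_{us}$ for $s\le u\le t$. Let $\mu_{ts}$ be the time-$1$ map ($x=y_0\mapsto y_1$) of the ordinary differential equation $\dot y_u=(t-s)V(y_u)+\big(X^i_{ts}V_i+\frac12\mathbb X^{jk}_{ts}[V_j,V_k]\big)(y_u)$, $0\le u\le1$. A flow $\varphi$ is a solution flow to the rough differential equation if there exist a constant $a>1$ independent of $\mathbf X$ and two possibly $\mathbf X$-dependent constants $\delta,c>0$ such that $\|\varphi_{ts}-\mu_{ts}\|_\infty\le c|t-s|^a$ for all $0\le s\le t\le T$ with $t-s\le\delta$. ''Uniformly Lipschitz'' means with Lipschitz constants bounded uniformly in $(s,t)$. Continuity of $\varphi$ as a function of $\mathbf X$ is with respect to $d$ and the uniform distance $\sup_{s\le t}\|\varphi_{ts}-\varphi'_{ts}\|_\infty$. *)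

(* Defs.v *)
From mathcomp Require Import all_boot all_order all_algebra.
From mathcomp Require Import all_classical all_reals all_analysis.

Set Implicit Arguments.
Unset Strict Implicit.
Unset Printing Implicit Defensive.

Import Order.TTheory GRing.Theory Num.Theory.
Import numFieldNormedType.Exports.

Local Open Scope classical_set_scope.
Local Open Scope ring_scope.

(* [iter_diff f [:: v_1; ...; v_k] x] is D^k f(x)[v_1, ..., v_k], where v_1 is
   the direction of the last differentiation. *)
Fixpoint iter_diff (R : realType) (E : normedModType R) (f : E -> E)
    (vs : seq E) : E -> E :=
  if vs is v :: vs' then fun x => 'd (iter_diff f vs') x v else f.

(* The operator norm of the j-linear map A : E^j -> E is at most M. *)
Definition multilinear_norm_le (R : realType) (E : normedModType R) (j : nat)
    (A : seq E -> E) (M : R) : Prop :=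
  forall vs : seq E, size vs = j -> `|A vs| <= M * \prod_(v <- vs) `|v|.

(* C^k_b: D^0 f, ..., D^(k-1) f are Frechet differentiable as maps into the
   spaces of bounded j-linear maps with the operator norm, and
   D^0 f, ..., D^k f are continuous and bounded for that norm.
   Multilinearity of D^j f(x) is not assumed: it follows by induction on j from
   the linearity of 'd f x in its argument and in f. *)
Record Ckb (R : realType) (E : normedModType R) (k : nat) (f : E -> E) : Prop :=
  { Ckb_differentiable : forall (vs : seq E) (x : E),
      (size vs < k)%N -> differentiable (iter_diff f vs) x ;
    Ckb_frechet : forall (j : nat) (x : E) (e : R), (j < k)%N -> 0 < e ->
      \forall y \near x, multilinear_norm_le j
        (fun vs => iter_diff f vs y - iter_diff f vs x
                   - iter_diff f ((y - x) :: vs) x) (e * `|y - x|) ;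
    Ckb_continuous : forall (j : nat) (x : E) (e : R), (j <= k)%N -> 0 < e ->
      \forall y \near x, multilinear_norm_le j
        (fun vs => iter_diff f vs y - iter_diff f vs x) e ;
    Ckb_bounded : forall j : nat, (j <= k)%N ->
      exists M : R, forall x : E,
        multilinear_norm_le j (fun vs => iter_diff f vs x) M }.

(* The vector field V as a first order differential operator g |-> Vg. *)
Definition vf_op (R : realType) (E : normedModType R) (V g : E -> E) : E -> E :=
  fun x => 'd g x (V x).

(* A first order operator is identified with the vector field obtained by
   applying it to the identity of E; in VW - WV the second order terms cancel. *)
Definition lie_bracket (R : realType) (E : normedModType R) (V W : E -> E) :
    E -> E :=
  fun x => vf_op V (vf_op W id) x - vf_op W (vf_op V id) x.

Lemma lie_bracketE (R : realType) (E : normedModType R) (V W : E -> E) (x : E) :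
  lie_bracket V W x = 'd W x (V x) - 'd V x (W x).
Proof.
have op_id (U : E -> E) : vf_op U id = U.
  apply/funext => y; rewrite /vf_op.
  by have -> : 'd (@id E) y = id :> (E -> E) by exact: diff_val.
by rewrite /lie_bracket !op_id.
Qed.

(* All two-parameter objects are written with the later time first, so that
   [rp1 X t s] is X_ts; only the values with 0 <= s <= t <= T matter. *)
Record rough_data (R : realType) (l : nat) := RoughData
  { rp1 : R -> R -> 'rV[R]_l ;
    rp2 : R -> R -> 'M[R]_l }.

(* Entry (j, k) is u^j v^k. *)
Definition tensor (R : realType) (l : nat) (u v : 'rV[R]_l) : 'M[R]_l :=
  u^T *m v.

Record rough_path (R : realType) (l : nat) (p T : R) (X : rough_data R l) :
    Prop :=
  { rough_path_chen1 : forall s u t : R, 0 <= s -> s <= u -> u <= t -> t <= T ->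
      rp1 X t s = rp1 X t u + rp1 X u s ;
    rough_path_chen2 : forall s u t : R, 0 <= s -> s <= u -> u <= t -> t <= T ->
      rp2 X t s = rp2 X t u + tensor (rp1 X u s) (rp1 X t u) + rp2 X u s ;
    rough_path_holder : exists C : R, forall s t : R,
      0 <= s -> s <= t -> t <= T ->
      `|rp1 X t s| <= C * (t - s) `^ (1 / p) /\
      `|rp2 X t s| <= C * (t - s) `^ (2 / p) }.

Definition weak_geometric (R : realType) (l : nat) (T : R)
    (X : rough_data R l) : Prop :=
  forall s t : R, 0 <= s -> s <= t -> t <= T ->
    2^-1 *: (rp2 X t s + (rp2 X t s)^T)
    = 2^-1 *: tensor (rp1 X t s) (rp1 X t s).

Definition rough_dist (R : realType) (l : nat) (p T : R)
    (X Y : rough_data R l) : \bar R :=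
  let simplex := [set st : R * R | [/\ 0 <= st.1, st.1 < st.2 & st.2 <= T]] in
  maxe
    (ereal_sup [set (`|rp1 X st.2 st.1 - rp1 Y st.2 st.1|
                     / (st.2 - st.1) `^ (1 / p))%:E | st in simplex])
    (ereal_sup [set (`|rp2 X st.2 st.1 - rp2 Y st.2 st.1|
                     / (st.2 - st.1) `^ (2 / p))%:E | st in simplex]).

Record is_flow (R : realType) (E : normedModType R) (T : R)
    (phi : R -> R -> E -> E) : Prop :=
  { is_flow_id : forall t : R, 0 <= t -> t <= T -> phi t t = id ;
    is_flow_comp : forall s u t : R, 0 <= s -> s <= u -> u <= t -> t <= T ->
      phi t s = phi t u \o phi u s }.

Definition flow_dist (R : realType) (E : normedModType R) (T : R)
    (phi psi : R -> R -> E -> E) : \bar R :=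
  ereal_sup [set z : \bar R | exists (s t : R) (x : E),
    [/\ 0 <= s, s <= t, t <= T & z = (`|phi t s x - psi t s x|)%:E]].

(* y solves y' = W(y) on [0, 1] from x, with one-sided derivatives at 0 and 1. *)
Definition ode_solution (R : realType) (E : normedModType R) (W : E -> E)
    (x : E) (y : R -> E) : Prop :=
  y 0 = x /\
  forall u : R, 0 <= u -> u <= 1 ->
    (v - u)^-1 *: (y v - y u) @[v --> within `[0%R, 1%R] u^'] --> W (y u).

(* In particular, solutions exist and their values at time 1 are unique. *)
Definition time1_map (R : realType) (E : normedModType R) (W m : E -> E) :
    Prop :=
  forall x z : E,
    m x = z <-> exists y : R -> E, ode_solution W x y /\ y 1 = z.

Definition rde_field (R : realType) (E : normedModType R) (l : nat)
    (V : E -> E) (F : 'I_l -> E -> E) (X : rough_data R l) (t s : R) : E -> E :=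
  fun x => (t - s) *: V x
    + (\sum_(i < l) rp1 X t s 0 i *: F i x
       + 2^-1 *: \sum_(j < l) \sum_(k < l)
                   rp2 X t s j k *: lie_bracket (F j) (F k) x).

(* phi is a flow, and is a solution with exponent a: the constants delta and c
   may depend on X, whereas a has to be quantified outside of X. *)
Definition solution_flow (R : realType) (E : normedModType R) (l : nat) (T : R)
    (V : E -> E) (F : 'I_l -> E -> E) (a : R) (X : rough_data R l)
    (phi : R -> R -> E -> E) : Prop :=
  is_flow T phi /\
  exists mu : R -> R -> E -> E,
    (forall s t : R, 0 <= s -> s <= t -> t <= T ->
       time1_map (rde_field V F X t s) (mu t s)) /\
    exists delta c : R, [/\ 0 < delta, 0 < c &
      forall s t : R, 0 <= s -> s <= t -> t <= T -> t - s <= delta ->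
        forall x : E, `|phi t s x - mu t s x| <= c * (t - s) `^ a].

Definition uniformly_lipschitz_homeo (R : realType) (E : normedModType R)
    (T : R) (phi : R -> R -> E -> E) : Prop :=
  exists L : R, forall s t : R, 0 <= s -> s <= t -> t <= T ->
    exists psi : E -> E,
      [/\ cancel (phi t s) psi, cancel psi (phi t s),
          continuous (phi t s), continuous psi &
          L.-lipschitz (phi t s) /\ L.-lipschitz psi].

(* Main.v *)
Require Import Defs.
From HB Require Import structures.
From mathcomp Require Import all_boot all_order all_algebra.
From mathcomp Require Import all_classical all_reals all_analysis.
From mathcomp Require Import ring lra.

Set Implicit Arguments.
Unset Strict Implicit.
Unset Printing Implicit Defensive.

Import Order.TTheory GRing.Theory Num.Theory.
Import numFieldNormedType.Exports.

Local Open Scope classical_set_scope.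
Local Open Scope ring_scope.

(** The flow is obtained by sewing an explicit scheme rather than the maps
    mu_ts themselves. With F_jk(x) = DV_k(x) V_j(x), put
      nu_ts(x) = x + (t - s) V(x) + X^i_ts V_i(x) + XX^jk_ts F_jk(x).
    Chen's relation cancels every term of nu_tu o nu_us - nu_ts of order less
    than 3/p in t - s, so that this difference is O((t - s)^(3/p)), and this
    holds in sup norm and for Lipschitz constants ([davie_almost_flow]). For a
    weak geometric rough path the symmetric part of XX_ts is the coefficient of
    the second order term of the Taylor expansion of mu_ts, hence mu_ts and
    nu_ts differ by O((t - s)^(3/p)) in sup norm ([rde_field_davie]): solution
    flows of the equation are the flows which stay close to nu.

    Sewing. Compose the maps of such an almost flow along a partition of
    [s, t]. Cutting the partition around the midpoint shows by induction that
    the composition differs from nu_ts by O((t - s)^a), a = 3/p, because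
    2 * 2^-a < 1; once this is known in sup norm it follows for Lipschitz
    constants ([chain_near]). Compositions are therefore uniformly Lipschitz
    ([chain_lip]), refining a partition of small mesh changes them little
    ([chain_refine], [chain_cauchy]), and they converge to a flow ([sewn]). The
    rate depends on nu only through the constants of its estimates. This gives
    the continuity in X: over a fixed partition the composition depends
    continuously on nu, hence on X ([sewn_continuous]). A path which follows nu
    up to o(h) over each time step h is a trajectory of the sewn flow
    ([sewn_track]), which is uniqueness. Over short times the flow is
    a perturbation of the identity with Lipschitz constant 1/2, so it has
    a Lipschitz inverse ([near_id_inverse]), and then so has it over all times.

    The derivatives of the vector fields enter through three inequalities only:
    a bound, a Lipschitz bound and a four point inequality ([four_point]), all
    of which come from a mean value inequality for maps from an interval to
    a Banach space ([mean_value]). No vector valued integral is used; in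
    particular the differential equation defining mu_ts is solved by sewing its
    Euler scheme ([time1_map_euler]). *)

(** * Linear identities and norm estimates *)

(** Reflected linear expressions: two of them are equal as soon as each of
    their atoms has the same coefficient in both. *)
Inductive vexpr (R : Type) : Type :=
  | VVar of nat
  | VZero
  | VAdd of vexpr R & vexpr R
  | VOpp of vexpr R
  | VScale of R & vexpr R.
Arguments VVar {R}. Arguments VZero {R}.

Fixpoint veval (R : pzRingType) (E : lmodType R) (env : seq E) (e : vexpr R) : E :=
  match e with
  | VVar n => nth 0 env n
  | VZero => 0
  | VAdd a b => veval env a + veval env b
  | VOpp a => - veval env a
  | VScale k a => k *: veval env a
  end.

Fixpoint vcoef (R : pzRingType) (e : vexpr R) (i : nat) : R :=
  match e with
  | VVar n => if eqn n i then 1 else 0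
  | VZero => 0
  | VAdd a b => vcoef a i + vcoef b i
  | VOpp a => - vcoef a i
  | VScale k a => k * vcoef a i
  end.

Fixpoint same_vcoef (R : pzRingType) (e1 e2 : vexpr R) (n : nat) : Prop :=
  if n is m.+1 then vcoef e1 m = vcoef e2 m /\ same_vcoef e1 e2 m else True.

Lemma veval_vcoef (R : pzRingType) (E : lmodType R) (env : seq E) (e : vexpr R) :
  veval env e = \sum_(i < size env) vcoef e i *: nth 0 env i.
Proof.
elim: e => [n||a IHa b IHb|a IHa|k a IHa] /=.
- have [lt_n|le_n] := ltnP n (size env).
    rewrite (bigD1 (Ordinal lt_n)) //= (introT eqnP erefl) scale1r big1 ?addr0 // => i.
    case: (@eqnP n i) => [eq_n|_ _]; last by rewrite scale0r.
    by rewrite -val_eqE /= -eq_n eqxx.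
  rewrite nth_default // big1 // => i _.
  case: (@eqnP n i) => [eq_n|_]; last by rewrite scale0r.
  by have := ltn_ord i; rewrite -eq_n ltnNge le_n.
- by rewrite big1 // => i _; rewrite scale0r.
- by rewrite IHa IHb -big_split /=; apply: eq_bigr => i _; rewrite scalerDl.
- by rewrite IHa -sumrN; apply: eq_bigr => i _; rewrite scaleNr.
- by rewrite IHa scaler_sumr; apply: eq_bigr => i _; rewrite scalerA.
Qed.

Lemma veval_eq (R : pzRingType) (E : lmodType R) (env : seq E) (e1 e2 : vexpr R) :
  same_vcoef e1 e2 (size env) -> veval env e1 = veval env e2.
Proof.
rewrite !veval_vcoef => eq_coef; apply: eq_bigr => i _.
elim: (size env) eq_coef i => [|n IHn] /=; first by move=> _ [].
move=> [eq_n eq_lt] i; have [lt_i|] := ltnP i n.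
  exact: (IHn eq_lt (Ordinal lt_i)).
move=> le_i; suff -> : (i : nat) = n by rewrite eq_n.
by apply/eqP; rewrite eqn_leq le_i -ltnS ltn_ord.
Qed.

(* Atoms are compared up to conversion: the same map may be seen as linear
   through distinct but convertible structures on E. *)
Ltac vindex x env :=
  lazymatch env with
  | x :: _ => constr:(Some 0%N)
  | ?y :: ?env' =>
      match goal with
      | _ => let _ := match goal with _ => unify x y end in constr:(Some 0%N)
      | _ => let r := vindex x env' in
             lazymatch r with Some ?n => constr:(Some (S n)) | None => r end
      end
  | _ => constr:(@None nat)
  end.

Ltac vatoms t env :=
  lazymatch t with
  | ?a + ?b => let env1 := vatoms a env in vatoms b env1
  | - ?a => vatoms a env
  | ?k *: ?a => vatoms a env
  | 0 => env
  | _ => let r := vindex t env in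
      lazymatch r with Some _ => env | None => constr:(t :: env) end
  end.

Ltac vreify R t env :=
  lazymatch t with
  | ?a + ?b => let ra := vreify R a env in let rb := vreify R b env in
      constr:(@VAdd R ra rb)
  | - ?a => let ra := vreify R a env in constr:(@VOpp R ra)
  | ?k *: ?a => let ra := vreify R a env in constr:(@VScale R k ra)
  | 0 => constr:(@VZero R)
  | _ => let r := vindex t env in
      lazymatch r with Some ?n => constr:(@VVar R n) end
  end.

(** The counterpart of ring for vectors: the coefficients of each atom on both
    sides are compared by ring. *)
Ltac vring R :=
  cbn beta;
  lazymatch goal with
  | |- @eq ?T ?a ?b =>
    let env0 := vatoms a (@nil T) in
    let env := vatoms b env0 in
    let ra := vreify R a env in
    let rb := vreify R b env in
    apply: (@veval_eq R _ env ra rb);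
    cbn [same_vcoef vcoef eqn size]; repeat split; ring
  end.

Section NormEstimates.
Variables (R : realType) (E : normedModType R).
Implicit Types (x y z : E) (a b c : R).

Lemma normD_le x a b y z : x = y + z -> `|y| <= a -> `|z| <= b -> `|x| <= a + b.
Proof. by move=> -> ya zb; apply: le_trans (ler_normD _ _) _; exact: lerD. Qed.

Lemma norm_triangle y x z a b : `|x - y| <= a -> `|y - z| <= b -> `|x - z| <= a + b.
Proof. by apply: normD_le; vring R. Qed.

Lemma normZ_le x (k : R) a b : `|k| <= a -> `|x| <= b -> `|k *: x| <= a * b.
Proof. by move=> ka xb; rewrite normrZ; apply: ler_pM. Qed.

Lemma le_of_le_mul_eps (u v k : R) : 0 <= k -> (forall e, 0 < e -> u <= v + k * e) -> u <= v.
Proof.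
move=> k0 H; apply/ler_addgt0Pr => e e0.
have k1 : 0 < k + 1 by lra.
apply: le_trans (H (e / (k + 1)) (divr_gt0 e0 k1)) _.
rewrite lerD2l mulrCA ger_pMr // ler_pdivrMr // mul1r; lra.
Qed.

End NormEstimates.

(** * The mean value inequality *)

Section MeanValue.
Variables (R : realType) (E : normedModType R).

(** The increments are spelled out so that the derivative is one-sided at the
    end points and no condition involves the values of f outside [a, b]. *)
Definition deriv_within (a b : R) (f df : R -> E) : Prop :=
  forall u, a <= u <= b -> forall e, 0 < e -> exists2 d, 0 < d &
    forall v, a <= v <= b -> `|v - u| <= d ->
      `|f v - f u - (v - u) *: df u| <= e * `|v - u|.

Lemma deriv_within_sub a b c d f df : a <= c -> d <= b ->
  deriv_within a b f df -> deriv_within c d f df.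
Proof.
move=> ac db Df u /andP[cu ud] e e0.
have [|k k0 Hk] := Df u _ e e0; first by lra.
by exists k => // v /andP[cv vd]; apply: Hk; lra.
Qed.

Lemma deriv_within_lin a b f df g dg (k m : R) :
  deriv_within a b f df -> deriv_within a b g dg ->
  deriv_within a b (fun u => k *: f u + m *: g u) (fun u => k *: df u + m *: dg u).
Proof.
move=> Df Dg u abu e e0.
pose K := `|k| + `|m| + 1.
have k0 := normr_ge0 k; have m0 := normr_ge0 m.
have K0 : 0 < K by rewrite /K; lra.
have [d1 d10 H1] := Df u abu (e / K) (divr_gt0 e0 K0).
have [d2 d20 H2] := Dg u abu (e / K) (divr_gt0 e0 K0).
exists (Num.min d1 d2) => [|v abv]; first by rewrite lt_min d10.
rewrite le_min => /andP[v1 v2].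
apply: le_trans (_ : `|k| * (e / K * `|v - u|) + `|m| * (e / K * `|v - u|) <= _).
  apply: normD_le (normZ_le (lexx _) (H1 v abv v1)) (normZ_le (lexx _) (H2 v abv v2)).
  vring R.
rewrite -mulrDl mulrA ler_wpM2r //.
rewrite mulrCA ger_pMr // ler_pdivrMr // mul1r /K; lra.
Qed.

Lemma deriv_within_ext a b f df g dg :
  (forall u, f u = g u) -> (forall u, a <= u <= b -> df u = dg u) ->
  deriv_within a b f df -> deriv_within a b g dg.
Proof.
move=> fg dfg Df u abu e e0; have [d d0 H] := Df u abu e e0.
by exists d => // v abv vd; rewrite -!fg -dfg //; apply: H.
Qed.

Lemma deriv_within_affine a b (x v : E) :
  deriv_within a b (fun u => x + u *: v) (fun=> v).
Proof.
move=> u _ e e0; exists 1 => // w _ _.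
rewrite [X in `|X|](_ : _ = 0); last by vring R.
by rewrite normr0 mulr_ge0 // ltW.
Qed.

Lemma deriv_within_quadratic a b (v : E) :
  deriv_within a b (fun u => (2^-1 * u ^+ 2) *: v) (fun u => u *: v).
Proof.
move=> u _ e e0; exists (e / (`|v| + 1)) => [|w _].
  by rewrite divr_gt0 // ltr_pwDr.
rewrite ler_pdivlMr ?ltr_pwDr // => uw.
rewrite [X in `|X|](_ : _ = (2^-1 * (w - u) ^+ 2) *: v); last first.
  rewrite -scalerBl scalerA -scalerBl; congr (_ *: _); by field.
rewrite normrZ normrM normrX gtr0_norm; last by rewrite invr_gt0.
have := normr_ge0 (w - u); have := normr_ge0 v; nra.
Qed.

(** The points of [a, b] up to which the inequality holds with a constant
    M' > M have a least upper bound; the inequality holds there, and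
    differentiability would let it continue if that point were not b. *)
Lemma mean_value a b f df (M : R) : a <= b -> deriv_within a b f df ->
  (forall u, a <= u <= b -> `|df u| <= M) -> `|f b - f a| <= M * (b - a).
Proof.
move=> ab Df dfM; apply: (@le_of_le_mul_eps _ _ _ (b - a)); first by lra.
move=> e e0; rewrite (mulrC _ e) -mulrDl; set M' := M + e.
pose S := [set u | a <= u <= b /\ `|f u - f a| <= M' * (u - a)].
have Sa : S a by split; [lra | rewrite !subrr normr0 mulr0].
have ubS : ubound S b by move=> u [/andP[]].
have hsS : has_sup S by split; [exists a | exists b].
set s := sup S.
have sb : s <= b by apply: ge_sup => //; exists a.
have sa : a <= s by apply: ub_le_sup => //; exists b.
have loc v u : `|f v - f u - (v - u) *: df u| <= e * `|v - u| -> a <= u <= b ->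
    `|f v - f u| <= M' * `|v - u|.
  move=> fvu abu; rewrite (_ : M' * _ = e * `|v - u| + `|v - u| * M); last first.
    by rewrite /M'; ring.
  apply: normD_le fvu (normZ_le (lexx _) (dfM u abu)); vring R.
have abs : a <= s <= b by rewrite sa.
have [d d0 Hd] := Df s abs e e0.
have Ss : `|f s - f a| <= M' * (s - a).
  have [u [abu fu] du] := sup_adherent d0 hsS.
  have us : u <= s by apply: ub_le_sup => //; exists b.
  rewrite -/s in du.
  have ns : `|u - s| = s - u by rewrite distrC ger0_norm //; lra.
  have := loc _ _ (Hd u abu _) abs; rewrite ns => /(_ ltac:(lra)) us'.
  rewrite (_ : M' * (s - a) = M' * (s - u) + M' * (u - a)); last by ring.
  by apply: norm_triangle fu; rewrite distrC.
suff <- : s = b by [].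
apply/eqP; rewrite eq_le sb /= leNgt; apply/negP => lt_sb.
pose v := Num.min b (s + d).
have sv : s < v by rewrite /v lt_min lt_sb ltrDl.
have vb : v <= b by rewrite /v ge_min lexx.
have vd : v <= s + d by rewrite /v ge_min lexx orbT.
have nv : `|v - s| = v - s by rewrite ger0_norm //; lra.
have abv : a <= v <= b by lra.
have := loc _ _ (Hd v abv _) abs; rewrite nv => /(_ ltac:(lra)) vs.
have : S v.
  split=> //; rewrite (_ : M' * (v - a) = M' * (v - s) + M' * (s - a)); last by ring.
  exact: norm_triangle vs Ss.
have /(_ v) := ub_le_sup (ex_intro _ b ubS); rewrite -/s => H /H; lra.
Qed.

End MeanValue.

(** * Functions with Lipschitz derivative *)

Section Regularity.
Variables (R : realType) (E : normedModType R).
Implicit Types (f g b : E -> E) (x y v : E).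

Definition bdd (M : R) f := forall x, `|f x| <= M.

Definition lip (M : R) f := forall x y, `|f x - f y| <= M * `|x - y|.

(** A derivative-free form of the bound M on Df and on the Lipschitz constant
    of Df. It controls the Lipschitz constant of f o g - f o h when g and h are
    close to each other. *)
Definition four_point (M : R) f := forall x y x' y',
  `|f x - f y - (f x' - f y')|
  <= M * (`|x - y - (x' - y')| + `|x - y| * (`|x - x'| + `|y - y'|)).

Record C11 (M : R) f : Prop := {
  C11_bdd : bdd M f;
  C11_lip : lip M f;
  C11_four : four_point M f }.

Lemma C11_ge0 M f : C11 M f -> 0 <= M.
Proof. by move=> /C11_bdd /(_ 0); apply: le_trans. Qed.

Lemma four_point_rhs_ge0 x y x' y' :
  0 <= `|x - y - (x' - y')| + `|x - y| * (`|x - x'| + `|y - y'|).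
Proof. by rewrite addr_ge0 // mulr_ge0 // addr_ge0. Qed.

Lemma lip_le M M' f : M <= M' -> lip M f -> lip M' f.
Proof. by move=> MM' H x y; apply: le_trans (H x y) _; apply: ler_wpM2r. Qed.

Lemma four_point_le M M' f : M <= M' -> four_point M f -> four_point M' f.
Proof.
move=> MM' H x y x' y'; apply: le_trans (H _ _ _ _) _.
by apply: ler_wpM2r => //; apply: four_point_rhs_ge0.
Qed.

Lemma C11_le M M' f : M <= M' -> C11 M f -> C11 M' f.
Proof.
move=> MM' [Hb Hl Hf]; split; [by move=> x; apply: le_trans (Hb x) MM'| |].
- exact: lip_le Hl.
- exact: four_point_le Hf.
Qed.

Lemma C11_0 : C11 0 (fun=> 0).
Proof.
by split=> [x|x y|x y x' y'] /=; rewrite ?subrr normr0 ?mul0r.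
Qed.

Lemma C11_add M N f g : C11 M f -> C11 N g -> C11 (M + N) (fun x => f x + g x).
Proof.
move=> [fb fl ff] [gb gl gf]; split=> [x|x y|x y x' y'].
- exact: normD_le (fb x) (gb x).
- rewrite mulrDl; apply: normD_le (fl x y) (gl x y); vring R.
- rewrite mulrDl; apply: normD_le (ff x y x' y') (gf x y x' y'); vring R.
Qed.

Lemma C11_scale M (k m : R) f : `|k| <= m -> C11 M f -> C11 (m * M) (fun x => k *: f x).
Proof.
move=> km [fb fl ff]; split=> [x|x y|x y x' y'].
- exact: normZ_le (fb x).
- rewrite -scalerBr -mulrA; exact: normZ_le (fl x y).
- rewrite -!scalerBr -mulrA; exact: normZ_le (ff x y x' y').
Qed.

Lemma C11_sum (I : finType) (M : I -> R) (f : I -> E -> E) :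
  (forall i, C11 (M i) (f i)) -> C11 (\sum_i M i) (fun x => \sum_i f i x).
Proof.
move=> H; elim: (index_enum I) => [|i s IHs].
  rewrite big_nil (_ : (fun=> _) = fun=> 0); first exact: C11_0.
  by apply/funext => x; rewrite big_nil.
rewrite big_cons (_ : (fun=> _) = fun x => f i x + \sum_(j <- s) f j x).
  exact: C11_add.
by apply/funext => x; rewrite big_cons.
Qed.

Lemma bdd_apply (A : E -> E -> E) M N b x :
  (forall x v, `|A x v| <= M * `|v|) -> 0 <= M -> bdd N b -> `|A x (b x)| <= M * N.
Proof. by move=> Ab M0 bN; apply: le_trans (Ab _ _) _; rewrite ler_wpM2l. Qed.

Lemma lip_apply (A : E -> {linear E -> E}) M N b :
  (forall x v, `|A x v| <= M * `|v|) -> (forall v, lip (M * `|v|) (A ^~ v)) ->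
  0 <= M -> bdd N b -> lip N b -> lip (2 * M * N) (fun x => A x (b x)).
Proof.
move=> Ab Al M0 bb bl x y.
have N0 : 0 <= N by apply: le_trans (bb 0).
have H1 : `|A x (b x - b y)| <= M * N * `|x - y|.
  by rewrite -mulrA; apply: le_trans (Ab _ _) _; rewrite ler_wpM2l.
have H2 : `|A x (b y) - A y (b y)| <= M * N * `|x - y|.
  apply: le_trans (Al (b y) x y) _.
  by rewrite ler_wpM2r // ler_wpM2l.
rewrite (_ : 2 * M * N * _ = M * N * `|x - y| + M * N * `|x - y|); last by ring.
apply: normD_le H1 H2; rewrite linearB /=; vring R.
Qed.

(** A field of linear maps applied to a vector field: each of the four terms into
    which the four point difference splits keeps a factor |x - y| or
    |x - y - (x' - y')|. *)
Lemma C11_apply (A : E -> {linear E -> E}) M N b :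
  (forall x v, `|A x v| <= M * `|v|) -> (forall v, lip (M * `|v|) (A ^~ v)) ->
  (forall v, four_point (M * `|v|) (A ^~ v)) -> 0 <= M -> C11 N b ->
  C11 (3 * M * N) (fun x => A x (b x)).
Proof.
move=> Ab Al Af M0 bC; have N0 := C11_ge0 bC; have [bb bl bf] := bC.
have MN0 : 0 <= M * N by rewrite mulr_ge0.
split=> [x||x y x' y'].
- apply: le_trans (bdd_apply x Ab M0 bb) _; lra.
- by apply: lip_le (lip_apply Ab Al M0 bb bl); lra.
set q := `|x - y - (x' - y')|; set d := `|x - y|.
set r := `|x - x'|; set r' := `|y - y'|.
have d0 : 0 <= d by rewrite /d. have q0 : 0 <= q by rewrite /q.
have r0 : 0 <= r by rewrite /r. have r'0 : 0 <= r' by rewrite /r'.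
have H1 : `|A x' (b x - b y - (b x' - b y'))| <= M * N * (q + d * (r + r')).
  by rewrite -mulrA; apply: le_trans (Ab _ _) _; rewrite ler_wpM2l //; apply: bf.
have H2 : `|A x (b x - b y) - A x' (b x - b y)| <= M * N * (d * r).
  apply: le_trans (Al _ x x') _.
  rewrite (_ : M * N * _ = M * (N * d) * r); last by ring.
  by rewrite ler_wpM2r // ler_wpM2l //; apply: bl.
have H3 : `|A x (b y') - A y (b y') - (A x' (b y') - A y' (b y'))|
    <= M * N * (q + d * (r + r')).
  apply: le_trans (Af (b y') x y x' y') _.
  by rewrite ler_wpM2r ?four_point_rhs_ge0 // ler_wpM2l.
have H4 : `|A x (b y - b y') - A y (b y - b y')| <= M * N * (d * r').
  apply: le_trans (Al _ x y) _.
  rewrite (_ : M * N * _ = M * (N * r') * d); last by ring.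
  by rewrite ler_wpM2r // ler_wpM2l //; apply: bl.
have := normD_le erefl (normD_le erefl H1 H2) (normD_le erefl H3 H4).
rewrite [X in `|X| <= _ -> _](_ : _ =
  A x (b x) - A y (b y) - (A x' (b x') - A y' (b y'))); last first.
  rewrite !linearB /=; vring R.
move/le_trans; apply.
rewrite -subr_ge0.
rewrite [X in 0 <= X](_ : _ = M * N * q); last by ring.
by rewrite mulr_ge0.
Qed.

End Regularity.

(** * Bounds on a C^k_b vector field *)

Section SmoothFields.
Variables (R : realType) (E : normedModType R).
Implicit Types (f g : E -> E) (x y v w : E).

Lemma line_deriv g x v (a b : R) : (forall z, differentiable g z) ->
  deriv_within a b (fun u => g (x + u *: v)) (fun u => 'd g (x + u *: v) v).
Proof.
move=> dg u _ e e0.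
have v1 : 0 < `|v| + 1 by rewrite ltr_pwDr.
have [_/posnumP[d] Hd] : exists2 d : R, 0 < d & forall h, `|h| < d ->
    `|g (x + u *: v + h) - g (x + u *: v) - 'd g (x + u *: v) h|
    <= e / (`|v| + 1) * `|h|.
  have /diff_locally/eqaddoP/(_ (e / (`|v| + 1)) (divr_gt0 e0 v1)) := dg (x + u *: v).
  move=> /nbhs_ballP[d /= d0 H]; exists d => // h hd.
  have := H h; rewrite -ball_normE /= sub0r normrN => /(_ hd).
  by rewrite -addrA -opprD [x + _ + h]addrC.
exists (d%:num / 2 / (`|v| + 1)) => [|w _]; first by rewrite divr_gt0.
rewrite ler_pdivlMr // => wu.
have := Hd ((w - u) *: v).
have d0 : 0 < d%:num by [].
have nwu := normr_ge0 (w - u); have nv := normr_ge0 v.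
rewrite normrZ => /(_ ltac:(nra)).
have -> : x + u *: v + (w - u) *: v = x + w *: v by vring R.
rewrite linearZ /= => /le_trans; apply.
rewrite mulrCA mulrC ler_wpM2r //.
rewrite mulrAC ler_pdivrMr //; nra.
Qed.

Lemma lip_of_diff g (M : R) : (forall z, differentiable g z) ->
  (forall x w, `|'d g x w| <= M * `|w|) -> lip M g.
Proof.
move=> dg gM x y.
have := mean_value ler01 (line_deriv y (x - y) dg) (fun u _ => gM _ (x - y)).
by rewrite scale1r scale0r addr0 subrKC subr0 mulr1.
Qed.

(** The mean value inequality along two segments at once: the derivative of
    g(y + u (x - y)) - g(y' + u (x' - y')) in u is
    Dg(z') (x - y - (x' - y')) + (Dg(z) - Dg(z')) (x - y), where z and z' are
    the current points of the segments. *)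
Lemma four_point_of_diff g (M : R) : 0 <= M -> (forall z, differentiable g z) ->
  (forall x w, `|'d g x w| <= M * `|w|) ->
  (forall w, lip (M * `|w|) (fun x => 'd g x w)) -> four_point M g.
Proof.
move=> M0 dg gM gl x y x' y'.
have D := deriv_within_lin 1 (-1) (line_deriv y (x - y) dg)
  (line_deriv y' (x' - y') dg).
set K := M * _; have := mean_value (M := K) ler01 (D 0 1); rewrite subr0 mulr1.
rewrite !scale1r !scale0r !addr0 !subrKC.
rewrite (_ : g x - g y - (g x' - g y') = g x + -1 *: g x' - (g y + -1 *: g y')); last by vring R.
apply; rewrite /K.
move=> u /andP[u0 u1].
set z := y + _; set z' := y' + _.
rewrite mulrDr; apply: (@normD_le _ _ _ _ _ ('d g z' (x - y - (x' - y')))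
    ('d g z (x - y) - 'd g z' (x - y))) => //.
  rewrite !linearB /=; vring R.
apply: le_trans (gl _ z z') _; rewrite -mulrA ler_wpM2l // ler_wpM2l //.
have -> : `|x - x'| + `|y - y'| = u * `|x - x'| + (1 - u) * `|y - y'|
  + ((1 - u) * `|x - x'| + u * `|y - y'|) by ring.
apply: ler_wpDr; first by rewrite addr_ge0 // mulr_ge0 //; lra.
apply: (@normD_le _ _ _ _ _ (u *: (x - x')) ((1 - u) *: (y - y'))).
- rewrite /z /z'; vring R.
- by rewrite normrZ ger0_norm.
- by rewrite normrZ ger0_norm //; lra.
Qed.

Record C2_bound (M : R) f : Prop := {
  C2_diff : forall x, differentiable f x;
  C2_C11 : C11 M f;
  C2_dbdd : forall x v, `|'d f x v| <= M * `|v|;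
  C2_dlip : forall v, lip (M * `|v|) (fun x => 'd f x v) }.

Record C3_bound (M : R) f : Prop := {
  C3_C2 : C2_bound M f;
  C3_dfour : forall v, four_point (M * `|v|) (fun x => 'd f x v) }.

Lemma C2_bound_le M M' f : M <= M' -> C2_bound M f -> C2_bound M' f.
Proof.
move=> MM' [df fC fb fl]; split=> //; first exact: C11_le fC.
- by move=> x v; apply: le_trans (fb x v) _; rewrite ler_wpM2r.
- by move=> v; apply: lip_le (fl v); rewrite ler_wpM2r.
Qed.

Lemma C3_bound_le M M' f : M <= M' -> C3_bound M f -> C3_bound M' f.
Proof.
move=> MM' [f2 ff]; split; first exact: C2_bound_le f2.
by move=> v; apply: four_point_le (ff v); rewrite ler_wpM2r.
Qed.

Lemma Ckb_bound k f : Ckb k f -> exists2 M : R, 0 <= M &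
  forall (vs : seq E) x, (size vs <= k)%N -> `|iter_diff f vs x| <= M * \prod_(v <- vs) `|v|.
Proof.
move=> [_ _ _ fb].
have /choice[m Hm] : forall j, exists M, (j <= k)%N -> forall x : E,
    multilinear_norm_le j (fun vs => iter_diff f vs x) M.
  by move=> j; case: (leqP j k) => [/fb[M HM]|]; [exists M | exists 0].
exists (\sum_(j < k.+1) `|m j|) => [|vs x sz]; first exact: sumr_ge0.
apply: le_trans (Hm _ sz x vs erefl) _; apply: ler_wpM2r.
  by apply: prodr_ge0.
apply: le_trans (ler_norm _) _.
rewrite (bigD1 (inord (size vs))) //= inordK // lerDl; exact: sumr_ge0.
Qed.

(** Every bound on a derivative is a Lipschitz or four point bound one or two
    orders below, since x |-> D^j f(x)[v_1, ..., v_j] has derivative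
    D^(j+1) f(x)[., v_1, ..., v_j]. *)
Lemma Ckb_C2_bound k f : (2 <= k)%N -> Ckb k f -> exists M : R, C2_bound M f.
Proof.
move=> k2 fk; have [M M0 HM] := Ckb_bound fk.
have d0 z : differentiable f z by apply: (Ckb_differentiable fk (vs := [::])); apply: ltn_trans k2.
have d1 v z : differentiable (fun x => 'd f x v) z.
  exact: (Ckb_differentiable fk (vs := [:: v])).
have fb x v : `|'d f x v| <= M * `|v|.
  by have := HM [:: v] x (ltnW k2); rewrite big_seq1.
have fl v : lip (M * `|v|) (fun x => 'd f x v).
  apply: lip_of_diff => // x w.
  by have := HM [:: w; v] x k2; rewrite big_cons big_seq1 /= mulrCA mulrC.
exists M; split=> //; split.
- by move=> x; have := HM [::] x isT; rewrite big_nil mulr1.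
- exact: lip_of_diff.
- exact: four_point_of_diff.
Qed.

Lemma Ckb_C3_bound f : Ckb 3 f -> exists M : R, C3_bound M f.
Proof.
move=> fk; have [M M0 HM] := Ckb_bound fk.
have [M' f2] := Ckb_C2_bound (isT : (1 < 3)%N) fk.
exists (Num.max M M'); split; first by apply: C2_bound_le f2; rewrite le_max lexx orbT.
move=> v; apply: (@four_point_le _ _ (M * `|v|)); first by rewrite ler_wpM2r // le_max lexx.
have d1 z : differentiable (fun x => 'd f x v) z.
  exact: (Ckb_differentiable fk (vs := [:: v])).
have b2 x w : `|'d (fun x => 'd f x v) x w| <= M * `|v| * `|w|.
  by have := HM [:: w; v] x isT; rewrite big_cons big_seq1 /= mulrA mulrAC.
apply: four_point_of_diff => //; first by rewrite mulr_ge0.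
move=> w; apply: lip_of_diff => [z|x u].
  exact: (Ckb_differentiable fk (vs := [:: w; v])).
have := HM [:: u; w; v] x isT; rewrite !big_cons big_nil mulr1 /=.
by rewrite (_ : M * `|v| * `|w| * `|u| = M * (`|u| * (`|w| * `|v|))); last ring.
Qed.

Definition taylor_rest f x v : E := f (x + v) - f x - 'd f x v.

Lemma taylor_rest_deriv f x v : (forall z, differentiable f z) ->
  deriv_within 0 1 (fun u => taylor_rest f x (u *: v))
    (fun u => 'd f (x + u *: v) v - 'd f x v).
Proof.
move=> df.
have := deriv_within_lin 1 (-1) (line_deriv x v df)
  (@deriv_within_affine _ _ 0 1 (f x) ('d f x v)).
apply: deriv_within_ext => [u|u _]; last by vring R.
rewrite /taylor_rest linearZ /=; vring R.
Qed.

Lemma taylor_rest0 f x : taylor_rest f x 0 = 0.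
Proof. by rewrite /taylor_rest linear0 addr0 !subrr. Qed.

Lemma taylor_rest_le M f x v : C2_bound M f -> `|taylor_rest f x v| <= M * `|v| ^+ 2.
Proof.
move=> fM; have M0 := C11_ge0 (C2_C11 fM).
have := mean_value (M := M * `|v| ^+ 2) ler01 (taylor_rest_deriv x v (C2_diff fM)).
rewrite scale1r scale0r taylor_rest0 !subr0 mulr1; apply => u /andP[u0 u1].
apply: le_trans (C2_dlip fM _ _ _) _.
rewrite addrAC subrr add0r normrZ ger0_norm // -mulrA ler_wpM2l //.
have := normr_ge0 v; nra.
Qed.

(** The difference of the two rests is the increment over [0, 1] of the difference
    of u |-> taylor_rest f x (u v) and u |-> taylor_rest f y (u w), whose
    derivatives are increments of Df, and the four point inequality of Df bounds
    their difference. *)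
Lemma taylor_rest_lip M f x y v w : C3_bound M f ->
  `|taylor_rest f x v - taylor_rest f y w|
  <= M * (`|v| * `|v - w| + `|w| * (`|v - w| + `|v| * (2 * `|x - y| + `|v - w|))).
Proof.
move=> [fM ff]; have M0 := C11_ge0 (C2_C11 fM).
have D := deriv_within_lin 1 (-1) (taylor_rest_deriv x v (C2_diff fM))
  (taylor_rest_deriv y w (C2_diff fM)).
set K := M * _; have := mean_value (M := K) ler01 D; rewrite subr0 mulr1.
rewrite !scale1r !scale0r !taylor_rest0 scaler0 addr0 subr0 scaleN1r.
apply; rewrite /K.
move=> u /andP[u0 u1]; rewrite scaleN1r mulrDr.
apply: (@normD_le _ _ _ _ _ ('d f (x + u *: v) (v - w) - 'd f x (v - w))
  ('d f (x + u *: v) w - 'd f x w - ('d f (y + u *: w) w - 'd f y w))).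
- rewrite !linearB /=; vring R.
- apply: le_trans (C2_dlip fM _ _ _) _.
  rewrite addrAC subrr add0r normrZ ger0_norm // -mulrA ler_wpM2l //.
  have := mulr_ge0 (normr_ge0 (v - w)) (normr_ge0 v); nra.
apply: le_trans (ff _ _ _ _ _) _; rewrite -mulrA ler_wpM2l // ler_wpM2l //.
have n1 : `|x + u *: v - x - (y + u *: w - y)| <= `|v - w|.
  rewrite (_ : _ - _ - _ = u *: (v - w)); last by vring R.
  by rewrite normrZ ger0_norm // ler_piMl.
have n2 : `|x + u *: v - x| <= `|v|.
  by rewrite addrAC subrr add0r normrZ ger0_norm // ler_piMl.
have n3 : `|x + u *: v - (y + u *: w)| <= `|x - y| + `|v - w|.
  apply: (@normD_le _ _ _ _ _ (x - y) (u *: (v - w))) => //; first by vring R.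
  by rewrite normrZ ger0_norm // ler_piMl.
apply: lerD n1 _; by apply: ler_pM => //; lra.
Qed.

End SmoothFields.

(** * Real powers *)

Section Powers.
Variable R : realType.
Implicit Types (a g c h : R).

Lemma powR_le a h h' : 0 <= a -> 0 <= h -> h <= h' -> h `^ a <= h' `^ a.
Proof. by move=> a0 h0 hh'; apply: ge0_ler_powR => //; rewrite nnegrE //; lra. Qed.

Lemma powR_small c g e : 0 <= c -> 0 < g -> 0 < e ->
  exists2 d, 0 < d & forall h, 0 <= h -> h <= d -> c * h `^ g <= e.
Proof.
move=> c0 g0 e0; have c1 : 0 < c + 1 by lra.
exists ((e / (c + 1)) `^ g^-1) => [|h h0 hd]; first by rewrite powR_gt0 // divr_gt0.
have := powR_le (ltW g0) h0 hd.
rewrite -powRrM mulVf ?gt_eqF // powRr1; last by rewrite divr_ge0 // ltW.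
rewrite ler_pdivlMr //.
have := powR_ge0 h g; nra.
Qed.

Lemma powR_super c a e : 0 <= c -> 1 < a -> 0 < e ->
  exists2 d, 0 < d & forall h, 0 <= h -> h <= d -> c * h `^ a <= e * h.
Proof.
move=> c0 a1 e0; have [d d0 Hd] := @powR_small c (a - 1) e c0 ltac:(lra) e0.
exists d => // h h0 hd; rewrite -(mulr_powRB1 h0); last by lra.
by rewrite mulrCA mulrC ler_wpM2r // Hd.
Qed.

Lemma powR_half a h h' : 0 <= a -> 0 <= h -> h <= h' / 2 -> h `^ a <= 2^-1 `^ a * h' `^ a.
Proof.
move=> a0 h0 hh'; rewrite -powRM ?invr_ge0 //; last by lra.
by apply: powR_le => //; rewrite mulrC.
Qed.

Lemma powR_half_lt a : 1 < a -> 2^-1 `^ a < 2^-1 :> R.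
Proof.
move=> a1; rewrite -(mulr_powRB1 (_ : 0 <= 2^-1 :> R)) ?invr_ge0 //; last by lra.
rewrite gtr_pMr ?invr_gt0 //.
have h1 : (2^-1 : R) < 1 by rewrite invf_lt1 // ltr1n.
have a10 : 0 < a - 1 by lra.
have := @gt0_ltr_powR R (a - 1) a10 2^-1 1.
by rewrite !nnegrE invr_ge0 powR1 => /(_ (ler0n _ _) ler01 h1).
Qed.

End Powers.

(** * Partitions *)

Section Partitions.
Variable R : realType.
Implicit Types (s t u v d m : R) (l : seq R).

(** The points of the partition other than s: there are none if s = t. *)
Definition partition_of s t l : Prop := path <%R s l /\ last s l = t.

Definition mesh_le d s l : Prop := path (fun u v => v - u <= d) s l.

Lemma path_le_last s l : path <%R s l -> s <= last s l.
Proof. by elim: l s => //= u l IHl s /andP[/ltW su /IHl]; apply: le_trans. Qed.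

Lemma path_mem s l u : path <%R s l -> u \in l -> s < u <= last s l.
Proof.
move=> sl ul; have /allP/(_ u ul) -> := order_path_min lt_trans sl => /=.
move: sl; case/splitPr: ul => l1 l2; rewrite cat_path last_cat /= => /and3P[_ _].
exact: path_le_last.
Qed.

Lemma path_split s l m : path <%R s l -> s <= m -> m < last s l ->
  exists l1 u l2, [/\ l = l1 ++ u :: l2, last s l1 <= m & m < u].
Proof.
elim: l s => [|u l IHl] s /=; first by move=> _ sm /(le_lt_trans sm); rewrite ltxx.
move=> /andP[su ul] sm ml; have [mu|um] := ltP m u; first by exists [::], u, l.
have [l1 [v [l2 [-> l1m mv]]]] := IHl u ul um ml.
by exists (u :: l1), v, l2.
Qed.

Lemma partition_cat s u t l l' :
  partition_of s u l -> partition_of u t l' -> partition_of s t (l ++ l').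
Proof. by move=> [sl lu] [ul' l't]; split; rewrite ?cat_path ?last_cat lu ?sl. Qed.

Lemma mesh_cat d s u l l' : partition_of s u l ->
  mesh_le d s l -> mesh_le d u l' -> mesh_le d s (l ++ l').
Proof. by move=> [_ lu] ml ml'; rewrite /mesh_le cat_path lu; apply/andP. Qed.

Lemma mesh_mono d d' s l : d <= d' -> mesh_le d s l -> mesh_le d' s l.
Proof. by move=> dd'; apply: sub_path => u v /= /le_trans; apply. Qed.

Lemma partition_le s t l : partition_of s t l -> s <= t.
Proof. by move=> [sl <-]; apply: path_le_last. Qed.

Lemma partition_nil s l : partition_of s s l -> l = [::].
Proof.
by case: l => // u l [/= /andP[su /path_le_last ul] lu]; move: ul; rewrite lu leNgt su.
Qed.

Lemma exists_partition (k : nat) d s t : 0 < d -> s <= t -> t - s <= k%:R * d ->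
  exists l, [/\ partition_of s t l, mesh_le d s l & (size l <= k)%N].
Proof.
move=> d0; elim: k s => [|k IHk] s st sk.
  have -> : s = t by rewrite mul0r in sk; lra.
  by exists [::].
have [ts|ts] := leP (t - s) d.
  move: st; rewrite le_eqVlt => /orP[/eqP ->|st]; first by exists [::].
  by exists [:: t]; split; rewrite /partition_of /mesh_le //= ?st ?ts.
rewrite -natr1 in sk.
have [||l [[pl ll] ml sl]] := IHk (s + d); [lra|lra|].
exists (s + d :: l); split=> //.
- by split=> //=; rewrite ltrDl d0.
- by rewrite /mesh_le /= ml addrAC subrr add0r lexx.
Qed.

Lemma common_refinement s t l1 l2 : partition_of s t l1 -> partition_of s t l2 ->
  exists l, [/\ partition_of s t l, {subset l1 <= l} & {subset l2 <= l}].
Proof.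
move=> p1 p2; have := partition_le p1; rewrite le_eqVlt => /orP[/eqP st|st].
  by move: p1 p2; rewrite st => p1 /partition_nil ->; exists l1; split.
have [[s1 t1] [s2 t2]] := (p1, p2).
pose l := sort <=%R (undup (l1 ++ l2)).
have inl u : (u \in l) = (u \in l1) || (u \in l2) by rewrite mem_sort mem_undup mem_cat.
have bnd u : u \in l -> s < u <= t.
  by rewrite inl => /orP[/(path_mem s1)|/(path_mem s2)]; rewrite ?t1 ?t2.
have tl : t \in l.
  rewrite inl; apply/orP; left; clear - st t1.
  by case: l1 t1 => [/= e|u l1' /= <-]; [rewrite e ltxx in st|apply: mem_last].
have pl : path <%R s l.
  rewrite (path_sortedE lt_trans) sort_lt_sorted undup_uniq andbT.
  by apply/allP => u /bnd /andP[].
exists l; split; [split=> //| |]; try by move=> u ul; rewrite inl ul ?orbT.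
apply/eqP; rewrite eq_le; have /andP[_ ->] := path_mem pl tl; rewrite andbT.
have := mem_last s l; rewrite inE => /orP[/eqP ->|/bnd /andP[]//]; exact: ltW.
Qed.

End Partitions.

(** * Sewing an almost flow *)

Section LipschitzCalculus.
Variables (R : realType) (E : normedModType R).
Implicit Types (f g h : E -> E).

Lemma lip_comp K L f g : 0 <= K -> lip K f -> lip L g -> lip (K * L) (f \o g).
Proof.
move=> K0 fK gL x y /=; apply: le_trans (fK _ _) _.
by rewrite -mulrA ler_wpM2l.
Qed.

Lemma lip_near e K f g : lip e (fun x => f x - g x) -> lip K g -> lip (e + K) f.
Proof. by move=> fg gK x y; rewrite mulrDl; apply: normD_le (fg x y) (gK x y); vring R. Qed.

Lemma lip_id : lip 1 (@id E).
Proof. by move=> x y; rewrite mul1r. Qed.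

(** Composing two nearby maps with f = id + N on the left: four points of N
    come in because the comparison has to be Lipschitz. *)
Lemma lip_post e K1 K2 L D f g h :
  0 <= e -> lip e (fun x => f x - x) -> four_point e (fun x => f x - x) ->
  lip K1 g -> lip K2 h -> (forall x, `|g x - h x| <= D) ->
  lip L (fun x => g x - h x) ->
  lip (L + e * (L + D * (K1 + K2))) (fun x => f (g x) - f (h x)).
Proof.
move=> e0 fl ff gK hK ghD ghL x y; rewrite mulrDl.
apply: normD_le (ghL x y) _; last first.
  apply: le_trans (ff (g x) (h x) (g y) (h y)) _.
  rewrite -mulrA ler_wpM2l // [leRHS]mulrDl -mulrA lerD ?ghL // ler_pM ?addr_ge0 //.
  by rewrite mulrDl lerD.
vring R.
Qed.

End LipschitzCalculus.

Section Sewing.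
Variables (R : realType) (E : completeNormedModType R).
Implicit Types (nu : R -> R -> E -> E) (T a g c s t u v d : R) (l : seq R) (x y : E).

Fixpoint chain nu s l x : E := if l is u :: l' then chain nu u l' (nu u s x) else x.

Lemma chain_cat nu s l l' x :
  chain nu s (l ++ l') x = chain nu (last s l) l' (chain nu s l x).
Proof. by elim: l s x => /=. Qed.

(** nu misses the flow property by an error of order a > 1, in sup norm and in
    Lipschitz seminorm. *)
Record almost_flow (T a g c : R) nu : Prop := {
  af_id : forall s x, 0 <= s -> s <= T -> nu s s x = x;
  af_lip : forall s t, 0 <= s -> s <= t -> t <= T ->
    lip (c * (t - s) `^ g) (fun x => nu t s x - x);
  af_four : forall s t, 0 <= s -> s <= t -> t <= T ->
    four_point (c * (t - s) `^ g) (fun x => nu t s x - x);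
  af_defect : forall s u t x, 0 <= s -> s <= u -> u <= t -> t <= T ->
    `|nu t u (nu u s x) - nu t s x| <= c * (t - s) `^ a;
  af_defect_lip : forall s u t, 0 <= s -> s <= u -> u <= t -> t <= T ->
    lip (c * (t - s) `^ a) (fun x => nu t u (nu u s x) - nu t s x) }.

(** The constants of the two inductions below: a partition of an interval of
    length h is cut around the midpoint into two partitions of length at most
    h / 2, and twice the factor 2^-a is less than 1, even with the
    Lipschitz constants 1 + e of short time steps taken into account. *)
Lemma sewing_constants a g c : 1 < a -> 0 < g -> 0 <= c -> exists k e C D d : R,
  [/\ [/\ 0 <= k, 0 < e, e <= 4^-1 & k = 2^-1 `^ a],
      [/\ 0 <= C, 0 <= D & 0 < d],
      k * (1 + (1 + e) ^+ 2) * C + 3 * c <= C,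
      k * ((1 + e) * (1 + 2 * e) + (1 + e) ^+ 2) * D + 15 * C + 9 * c <= D &
      forall h, 0 <= h -> h <= d -> c * h `^ g <= e /\ D * h `^ a <= e].
Proof.
move=> a1 g0 c0; pose k : R := 2^-1 `^ a.
have k0 : 0 < k by rewrite powR_gt0 // invr_gt0.
have k2 : k < 2^-1 by apply: powR_half_lt.
pose e : R := Num.min 4^-1 ((1 - 2 * k) / (2 * k) / 10).
have e0 : 0 < e by rewrite lt_min invr_gt0 ltr0n /= !divr_gt0 ?mulr_gt0 //; lra.
have e4 : e <= 4^-1 by rewrite ge_min lexx.
pose q : R := (1 - 2 * k) / 2.
have q0 : 0 < q by rewrite divr_gt0 //; lra.
have ke : k * (2 + 10 * e) <= 1 - q.
  have : e <= (1 - 2 * k) / (2 * k) / 10 by rewrite ge_min lexx orbT.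
  rewrite ler_pdivlMr // ler_pdivlMr ?mulr_gt0 // /q; nra.
pose C : R := 3 * c / q; pose D : R := (15 * C + 9 * c) / q.
have Cq : C * q = 3 * c by rewrite /C divfK // gt_eqF.
have Dq : D * q = 15 * C + 9 * c by rewrite /D divfK // gt_eqF.
have C0 : 0 <= C by rewrite -(pmulr_lge0 _ q0) Cq; lra.
have D0 : 0 <= D by rewrite -(pmulr_lge0 _ q0) Dq; lra.
have [d1 d10 H1] := powR_small c0 g0 e0.
have [d2 d20 H2] := powR_small D0 (lt_trans ltr01 a1) e0.
exists k, e, C, D, (Num.min d1 d2); split.
- by rewrite ltW.
- by rewrite lt_min d10 d20.
- have : k * (1 + (1 + e) ^+ 2) <= 1 - q by apply: le_trans ke; rewrite (ler_wpM2l (ltW k0)) //; nra.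
  move=> /(ler_wpM2r C0); nra.
- have : k * ((1 + e) * (1 + 2 * e) + (1 + e) ^+ 2) <= 1 - q.
    by apply: le_trans ke; rewrite (ler_wpM2l (ltW k0)) //; nra.
  move=> /(ler_wpM2r D0); nra.
- by move=> h h0; rewrite le_min => /andP[hd1 hd2]; split; [apply: H1|apply: H2].
Qed.

(** One step of the induction in [chain_near]. The maps A and B are the
    compositions over the two halves of a partition, of length at most half the
    total; N1, N2, N3 are the maps of the almost flow over the three intervals
    of the cut, N12 and N those over the union of the first two and over the
    whole interval; k stands for 2^-a and H for the a-th power of the length. *)
Lemma three_step_sup (k e c C H : R) (A B N1 N2 N3 N12 N : E -> E) :
  0 <= k -> 0 <= e -> e <= 4^-1 -> 0 <= c -> 0 <= H ->
  k * (1 + (1 + e) ^+ 2) * C + 3 * c <= C ->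
  lip (1 + e) N2 -> lip (1 + e) N3 ->
  (forall x, `|A x - N1 x| <= C * (k * H)) ->
  (forall x, `|B x - N3 x| <= C * (k * H)) ->
  (forall x, `|N2 (N1 x) - N12 x| <= c * H) ->
  (forall x, `|N3 (N12 x) - N x| <= c * H) ->
  forall x, `|B (N2 (A x)) - N x| <= C * H.
Proof.
move=> k0 e0 e4 c0 H0 HC L2 L3 dA dB d3 d4 x.
have e1 : 0 <= 1 + e by rewrite addr_ge0.
have d2 := le_trans (L2 _ _) (ler_wpM2l e1 (dA x)).
apply: le_trans (norm_triangle (dB _) (norm_triangle (le_trans (L3 _ _) (ler_wpM2l e1 d2))
  (norm_triangle (le_trans (L3 _ _) (ler_wpM2l e1 (d3 x))) (d4 x)))) _.
apply: le_trans (ler_wpM2r H0 HC).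
have := ler_wpM2r (mulr_ge0 c0 H0) e4; have := mulr_ge0 c0 H0.
move=> cH0 ecH; rewrite -subr_ge0 [X in 0 <= X](_ : _ = c * H - e * (c * H)); last by ring.
lra.
Qed.

(** The uniform bound C enters because Lipschitz constants of f o g - f o h
    involve the sup norm of g - h, by [lip_post]. *)
Lemma three_step_lip (k e c C D H : R) (A B N1 N2 N3 N12 N : E -> E) :
  0 <= k -> k <= 2^-1 -> 0 <= e -> e <= 4^-1 -> 0 <= c -> 0 <= C -> 0 <= D -> 0 <= H ->
  k * ((1 + e) * (1 + 2 * e) + (1 + e) ^+ 2) * D + 15 * C + 9 * c <= D ->
  lip e (fun x => N2 x - x) -> four_point e (fun x => N2 x - x) ->
  lip e (fun x => N3 x - x) -> four_point e (fun x => N3 x - x) ->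
  lip (1 + 2 * e) A -> lip (1 + e) N1 -> lip (1 + e) N2 -> lip (1 + e) N12 ->
  (forall x, `|A x - N1 x| <= C * (k * H)) ->
  (forall x, `|N2 (N1 x) - N12 x| <= c * H) ->
  lip (D * (k * H)) (fun x => A x - N1 x) ->
  lip (D * (k * H)) (fun x => B x - N3 x) ->
  lip (c * H) (fun x => N2 (N1 x) - N12 x) ->
  lip (c * H) (fun x => N3 (N12 x) - N x) ->
  lip (D * H) (fun x => B (N2 (A x)) - N x).
Proof.
move=> k0 k2 e0 e4 c0 C0 D0 H0 HD l2e f2e l3e f3e LA L1 L2 L12 dA d3 dlA dlB dl3 dl4.
have e1 : 0 <= 1 + e by rewrite addr_ge0.
have LNA : lip ((1 + e) * (1 + 2 * e)) (N2 \o A) by apply: lip_comp.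
have LNN : lip ((1 + e) * (1 + e)) (N2 \o N1) by apply: lip_comp.
have d2 x : `|N2 (A x) - N2 (N1 x)| <= (1 + e) * (C * (k * H)).
  by apply: le_trans (L2 _ _) _; rewrite ler_wpM2l.
have kH0 : 0 <= k * H by rewrite mulr_ge0.
have T1 := lip_comp (g := N2 \o A) (mulr_ge0 D0 kH0) dlB LNA.
have T2a := lip_post e0 l2e f2e LA L1 dA dlA.
have T2 := lip_post e0 l3e f3e LNA LNN d2 T2a.
have T3 := lip_post e0 l3e f3e LNN L12 d3 dl3.
move=> x y.
have := normD_le erefl (normD_le erefl (T1 x y) (T2 x y)) (normD_le erefl (T3 x y) (dl4 x y)).
rewrite /= [X in `|X| <= _ -> _](_ : _ = B (N2 (A x)) - N x - (B (N2 (A y)) - N y)); last first.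
  by vring R.
move/le_trans; apply; rewrite -!mulrDl ler_wpM2r //.
apply: le_trans (ler_wpM2r H0 HD).
have kC : k * H * C <= 2^-1 * (H * C) by rewrite -mulrA ler_wpM2r ?mulr_ge0.
have cH := mulr_ge0 c0 H0; have kC0 := mulr_ge0 kH0 C0.
have ee : e * e <= e by rewrite ler_piMr //; lra.
have eee : e * (e * e) <= e by exact: le_trans (ler_wpM2l e0 ee) ee.
have eeee : e * (e * (e * e)) <= e by exact: le_trans (ler_wpM2l e0 eee) ee.
rewrite -subr_ge0; move: kC kC0 cH ee eee eeee e0 e4; clear.
set p := e * e; set q := e * p; set r := e * q => kC kC0 cH ep eq er e0 e4.
have kCe z : 0 <= z -> 0 <= k * H * C * z by apply: mulr_ge0.
have cHe z : 0 <= z -> 0 <= c * H * z by apply: mulr_ge0.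
have := kCe (30 - (1 + e) * e * (2 + 3 * e)
  - e * (1 + e) * ((1 + e) * (1 + 2 * e) + (1 + e) * (1 + e))).
have := cHe (7 - e * (1 + (1 + e) * (1 + e) + (1 + e))).
have -> : e * (1 + (1 + e) * (1 + e) + (1 + e)) = 3 * e + 3 * p + q by rewrite /q /p; ring.
have -> : 30 - (1 + e) * e * (2 + 3 * e)
  - e * (1 + e) * ((1 + e) * (1 + 2 * e) + (1 + e) * (1 + e))
  = 30 - 4 * e - 12 * p - 11 * q - 3 * r by rewrite /r /q /p; ring.
move=> /(_ ltac:(lra)) H1 /(_ ltac:(lra)) H2.
rewrite [X in 0 <= X](_ : _ = c * H * (7 - (3 * e + 3 * p + q))
  + k * H * C * (30 - 4 * e - 12 * p - 11 * q - 3 * r)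
  + 30 * (2^-1 * (H * C) - k * H * C)); first by lra.
by rewrite /r /q /p; field.
Qed.

(** Strong induction on the number of points, cutting the partition at the two
    consecutive points around the midpoint. *)
Lemma chain_near T a g c : 1 < a -> 0 < g -> 0 <= c -> exists C d : R,
  [/\ 0 <= C, 0 < d, forall h, 0 <= h -> h <= d -> c * h `^ g + C * h `^ a <= 2^-1 &
  forall nu, almost_flow T a g c nu -> forall s t l, 0 <= s -> t <= T -> t - s <= d ->
    partition_of s t l ->
    (forall x, `|chain nu s l x - nu t s x| <= C * (t - s) `^ a) /\
    lip (C * (t - s) `^ a) (fun x => chain nu s l x - nu t s x)].
Proof.
move=> a1 g0 c0.
have [k [e [C [D [d [[k0 e0 e4 kE] [C0 D0 d0] HC HD small]]]]]] := sewing_constants a1 g0 c0.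
have e0' := ltW e0; have e1 : 0 <= 1 + e by rewrite addr_ge0.
have k2 : k <= 2^-1 by rewrite kE ltW // powR_half_lt.
have a0 : 0 <= a by rewrite (le_trans ler01) // ltW.
have CD : C <= D.
  apply: le_trans HD; rewrite -subr_ge0.
  have : 0 <= k * ((1 + e) * (1 + 2 * e) + (1 + e) ^+ 2) * D.
    by rewrite mulr_ge0 // mulr_ge0 //; nra.
  lra.
have ra h : 0 <= h `^ a by apply: powR_ge0.
exists D, d; split=> // [h h0 hd|nu nuP s t l].
  by have [] := small h h0 hd; lra.
suff: 0 <= s -> t <= T -> t - s <= d -> partition_of s t l ->
    (forall x, `|chain nu s l x - nu t s x| <= C * (t - s) `^ a) /\
    lip (D * (t - s) `^ a) (fun x => chain nu s l x - nu t s x).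
  move=> H s0 tT ts pl; have [H1 H2] := H s0 tT ts pl; split=> // x.
  by apply: le_trans (H1 x) _; rewrite ler_wpM2r.
have [n] := ubnP (size l); elim: n s t l => // n IHn s t l sz s0 tT ts pl.
have := partition_le pl; rewrite le_eqVlt => /orP[/eqP st|st].
  move: pl; rewrite -st => /partition_nil -> /=.
  have E0 x : x - nu s s x = 0 by rewrite (af_id nuP) ?subrr // st.
  have h0 : 0 <= (s - s) `^ a by exact: ra.
  split=> [x|x y]; first by rewrite E0 normr0 mulr_ge0.
  by rewrite !E0 subrr normr0 !mulr_ge0.
have [ps lt] := pl.
pose m : R := (s + t) / 2.
have sm : s <= m by rewrite /m; clear -st; lra.
have mt : m < t by rewrite /m; clear -st; lra.
rewrite -lt in mt.
have [l1 [u' [l2 [lE um mu']]]] := path_split ps sm mt.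
move: um; set u := last s l1 => um.
have /and3P[p1 uu' p2] : [&& path <%R s l1, u < u' & path <%R u' l2].
  by move: ps; rewrite lE cat_path.
have {}lt : last u' l2 = t by rewrite -lt lE last_cat.
have su : s <= u := path_le_last p1.
have u't : u' <= t by rewrite -lt; apply: path_le_last.
have {}uu' := ltW uu'.
have sz1 : (size l1 < n)%N.
  by move: sz; rewrite lE size_cat /= addnS ltnS; apply: leq_ltn_trans; rewrite leq_addr.
have sz2 : (size l2 < n)%N.
  by move: sz; rewrite lE size_cat /= addnS ltnS; apply: leq_ltn_trans; rewrite leq_addl.
have ut := le_trans uu' u't; have su' := le_trans su uu'.
have uT := le_trans ut tT; have u'T := le_trans u't tT.
have u0 := le_trans s0 su; have u'0 := le_trans s0 su'.
have sub v w : s <= v -> w <= t -> w - v <= t - s by move=> *; apply: lerB.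
have [IHa IHal] := IHn s u l1 sz1 s0 uT (le_trans (sub _ _ (lexx _) ut) ts) (conj p1 erefl).
have [IHb IHbl] := IHn u' t l2 sz2 u'0 tT (le_trans (sub _ _ su' (lexx _)) ts) (conj p2 lt).
have hA : (u - s) `^ a <= k * (t - s) `^ a.
  by rewrite kE; apply: powR_half; rewrite ?subr_ge0 //; rewrite /m in um; clear -um; lra.
have hB : (t - u') `^ a <= k * (t - s) `^ a.
  by rewrite kE; apply: powR_half; rewrite ?subr_ge0 //; rewrite /m in mu'; clear -mu'; lra.
(* short time steps are e-close to the identity *)
have near v w : s <= v -> v <= w -> w <= t ->
    [/\ lip e (fun x => nu w v x - x), four_point e (fun x => nu w v x - x) & lip (1 + e) (nu w v)].
  move=> sv vw wt.
  have v0 := le_trans s0 sv; have wT := le_trans wt tT.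
  have [ce _] : c * (w - v) `^ g <= e /\ D * (w - v) `^ a <= e.
    by apply: small; rewrite ?subr_ge0 //; apply: le_trans (sub _ _ sv wt) ts.
  have le := lip_le ce (af_lip nuP v0 vw wT).
  split=> //; last by rewrite addrC; apply: lip_near le (@lip_id _ _).
  exact: four_point_le ce (af_four nuP v0 vw wT).
have [_ _ L1] := near s u (lexx _) su ut.
have [l2e f2e L2] := near u u' su uu' u't.
have [l3e f3e L3] := near u' t su' u't (lexx _).
have [_ _ L12] := near s u' (lexx _) su' u't.
have LA : lip (1 + 2 * e) (chain nu s l1).
  apply: lip_le (lip_near IHal L1).
  have [_] : c * (u - s) `^ g <= e /\ D * (u - s) `^ a <= e.
    by apply: small; rewrite ?subr_ge0 //; apply: le_trans (sub _ _ (lexx _) ut) ts.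
  by clear; lra.
have hM v w : s <= v -> v <= w -> w <= t -> c * (w - v) `^ a <= c * (t - s) `^ a.
  by move=> sv vw wt; rewrite ler_wpM2l // powR_le ?subr_ge0 // sub.
have dA x : `|chain nu s l1 x - nu u s x| <= C * (k * (t - s) `^ a).
  by apply: le_trans (IHa x) _; rewrite ler_wpM2l.
have dB x : `|chain nu u' l2 x - nu t u' x| <= C * (k * (t - s) `^ a).
  by apply: le_trans (IHb x) _; rewrite ler_wpM2l.
have d3 x : `|nu u' u (nu u s x) - nu u' s x| <= c * (t - s) `^ a.
  exact: le_trans (af_defect nuP x s0 su uu' u'T) (hM _ _ (lexx _) su' u't).
have d4 x : `|nu t u' (nu u' s x) - nu t s x| <= c * (t - s) `^ a.
  exact: (af_defect nuP x s0 su' u't tT).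
have chE : chain nu s l = fun x => chain nu u' l2 (nu u' u (chain nu s l1 x)).
  by apply/funext => x; rewrite lE chain_cat.
rewrite chE; split.
  exact: (three_step_sup k0 e0' e4 c0 (ra _) HC L2 L3 dA dB d3 d4).
apply: (three_step_lip k0 k2 e0' e4 c0 C0 D0 (ra _) HD l2e f2e l3e f3e LA L1 L2 L12 dA d3).
- by apply: lip_le IHal; rewrite ler_wpM2l.
- by apply: lip_le IHbl; rewrite ler_wpM2l.
- exact: lip_le (hM _ _ (lexx _) su' u't) (af_defect_lip nuP s0 su uu' u'T).
- exact: (af_defect_lip nuP s0 su' u't tT).
Qed.

End Sewing.

Section SewingLimit.
Variables (R : realType) (E : completeNormedModType R).
Implicit Types (nu : R -> R -> E -> E) (T a g c e s t u v d : R) (l : seq R) (x y : E).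

(** Over a short interval this is [chain_near]; an interval of length T is cut
    into about T / d short ones. *)
Lemma chain_lip T a g c : 1 < a -> 0 < g -> 0 <= c -> exists2 L : R, 0 <= L &
  forall nu, almost_flow T a g c nu -> forall s t l, 0 <= s -> t <= T ->
    partition_of s t l -> lip L (chain nu s l).
Proof.
move=> a1 g0 c0; have [C [d [C0 d0 Cd near]]] := chain_near E T a1 g0 c0.
pose K : R := 2 + c * T `^ g.
have cT : 0 <= c * T `^ g by rewrite mulr_ge0 // powR_ge0.
have K1 : 1 <= K by rewrite /K; clear -cT; lra.
have K0 := le_trans ler01 K1.
have [n Tn] : exists n : nat, T <= n.+1%:R * d.
  by exists (Num.truncn (T / d)); rewrite -ler_pdivrMr // ltW // truncnS_gt.
exists (K ^+ (2 * n).+1) => [|nu nuP s t l s0 tT pl]; first exact: exprn_ge0.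
have step u v : 0 <= u -> u <= v -> v <= T -> lip K (nu v u).
  move=> u0 uv vT.
  apply: lip_le (lip_near (af_lip nuP u0 uv vT) (@lip_id _ _)).
  have : c * (v - u) `^ g <= c * T `^ g.
    by rewrite ler_wpM2l // (powR_le (ltW g0)) ?subr_ge0 //; clear -u0 vT; lra.
  by rewrite /K; clear; lra.
have : t - s <= n.+1%:R * d by apply: le_trans Tn; clear -s0 tT; lra.
elim: n s l s0 pl {Tn} => [|n IHn] s l s0 pl ts.
  have st := partition_le pl; rewrite mul1r in ts.
  have [_ lipD] := near nu nuP s t l s0 tT ts pl.
  rewrite expr1; apply: lip_le (lip_near lipD (lip_near (af_lip nuP s0 st tT) (@lip_id _ _))).
  have := Cd (t - s); rewrite subr_ge0 => /(_ st ts).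
  by rewrite /K; clear -cT; lra.
(* the points up to s + d make a short partition, followed by one step past
   s + d and by a partition of an interval shorter by d *)
have [ts'|st'] := leP (t - s) d.
  have st := partition_le pl.
  have [_ lipD] := near nu nuP s t l s0 tT ts' pl.
  apply: lip_le (lip_near lipD (lip_near (af_lip nuP s0 st tT) (@lip_id _ _))).
  have := Cd (t - s); rewrite subr_ge0 => /(_ st ts') H.
  apply: le_trans (_ : K <= _); last by rewrite exprS ler_peMr // exprn_ege1.
  by rewrite /K; clear -cT H; lra.
have [ps lt] := pl.
have sd : s <= s + d by rewrite lerDl ltW.
have dl : s + d < last s l by rewrite lt; clear -st'; lra.
have [l1 [u [l2 [lE l1d du]]]] := path_split ps sd dl.
have /and3P[p1 l1u p2] : [&& path <%R s l1, last s l1 < u & path <%R u l2].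
  by move: ps; rewrite lE cat_path.
have {}lt : last u l2 = t by rewrite -lt lE last_cat.
have s1 := path_le_last p1; have ut : u <= t by rewrite -lt; apply: path_le_last.
have u0 : 0 <= u by apply: le_trans s0 (le_trans sd (ltW du)).
have uT := le_trans ut tT.
have L1 : lip K (chain nu s l1).
  have l1T : last s l1 <= T by apply: le_trans (ltW l1u) uT.
  have l1s : last s l1 - s <= d by rewrite lerBlDl.
  have [_ lipD] := near nu nuP s (last s l1) l1 s0 l1T l1s (conj p1 erefl).
  apply: lip_le (lip_near lipD (lip_near (af_lip nuP s0 s1 l1T) (@lip_id _ _))).
  have := Cd (last s l1 - s); rewrite subr_ge0 => /(_ s1 l1s).
  by rewrite /K; clear -cT; lra.
have L2 := IHn u l2 u0 (conj p2 lt).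
have L3 := step _ _ (le_trans s0 s1) (ltW l1u) uT.
rewrite (_ : chain nu s l = chain nu u l2 \o (nu u (last s l1) \o chain nu s l1)); last first.
  by apply/funext => x; rewrite lE chain_cat.
rewrite (_ : K ^+ (2 * n.+1).+1 = K ^+ (2 * n).+1 * (K * K)); last first.
  by rewrite mulnS -addnS exprD expr2 mulrC.
apply: lip_comp (lip_comp K0 L3 L1); first exact: exprn_ge0.
apply: L2; move: ts; rewrite -(natr1 n.+1) => ts.
by clear -ts du; lra.
Qed.

(** The chain along the finer partition l' is compared with the one along l by
    replacing, one step of l after the other, the part of l' inside that step. *)
Lemma chain_refine T a g c nu L C d r s t l l' :
  almost_flow T a g c nu -> 0 <= L -> 0 <= s -> t <= T ->
  (forall s t l, 0 <= s -> t <= T -> partition_of s t l -> lip L (chain nu s l)) ->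
  (forall s t l x, 0 <= s -> t <= T -> t - s <= d -> partition_of s t l ->
     `|chain nu s l x - nu t s x| <= C * (t - s) `^ a) ->
  (forall h, 0 <= h -> h <= d -> C * h `^ a <= r * h) ->
  partition_of s t l -> partition_of s t l' -> {subset l <= l'} -> mesh_le d s l ->
  forall x, `|chain nu s l' x - chain nu s l x| <= L * r * (t - s).
Proof.
move=> nuP L0 s0 tT Llip near rC; elim: l s l' s0 => [|u l IHl] s l' s0 [pl lt] [pl' lt'] sub ml x.
  move: lt lt' pl' => /= <- lt' pl'; rewrite (partition_nil (conj pl' lt')) /=.
  by rewrite !subrr normr0 mulr0.
move: pl lt ml => /= /andP[su pl] lt /andP[du ml].
have ul' : u \in l' by apply: sub; rewrite inE eqxx.
have ut : u <= t by have /andP[_] := path_mem pl' ul'; rewrite lt'.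
case/splitPr: ul' pl' lt' sub => l1 l2; rewrite cat_path last_cat /= => /and3P[p1 l1u p2] lt2 sub.
have p1u : partition_of s u (rcons l1 u) by split; rewrite ?rcons_path ?p1 ?last_rcons.
have sub2 : {subset l <= l2}.
  move=> w wl; have /andP[uw _] := path_mem pl wl.
  have : w \in l1 ++ u :: l2 by apply: sub; rewrite inE wl orbT.
  rewrite -cat_rcons mem_cat => /orP[wl1|//].
  have [p1' e] := p1u; have /andP[_] := path_mem p1' wl1.
  by rewrite e leNgt uw.
have u0 : 0 <= u by apply: le_trans s0 (ltW su).
rewrite -cat_rcons chain_cat last_rcons.
rewrite (_ : _ * (t - s) = L * (r * (u - s)) + L * r * (t - u)); last by ring.
apply: norm_triangle (IHl u l2 u0 (conj pl lt) (conj p2 lt2) sub2 ml (nu u s x)).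
apply: le_trans (Llip u t l2 u0 tT (conj p2 lt2) _ _) _.
apply: ler_wpM2l => //; apply: le_trans (near _ _ _ _ s0 (le_trans ut tT) du p1u) _.
by apply: rC du; rewrite subr_ge0 ltW.
Qed.

(** Any two fine partitions are compared with a common refinement. *)
Lemma chain_cauchy T a g c e : 0 < T -> 1 < a -> 0 < g -> 0 <= c -> 0 < e ->
  exists2 d : R, 0 < d & forall nu, almost_flow T a g c nu ->
    forall s t l l' x, 0 <= s -> t <= T -> partition_of s t l -> partition_of s t l' ->
      mesh_le d s l -> mesh_le d s l' -> `|chain nu s l x - chain nu s l' x| <= e.
Proof.
move=> T0 a1 g0 c0 e0; have [C [d1 [C0 d10 _ near]]] := chain_near E T a1 g0 c0.
have [L L0 Llip] := chain_lip T a1 g0 c0.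
pose r : R := e / (2 * (L + 1) * T).
have L1 : 0 < L + 1 by rewrite ltr_wpDl.
have r0 : 0 < r by rewrite divr_gt0 // mulr_gt0 // mulr_gt0.
have rE : r * (2 * (L + 1) * T) = e by rewrite /r divfK // gt_eqF // mulr_gt0 // mulr_gt0.
have [d2 d20 rC] := powR_super C0 a1 r0.
exists (Num.min d1 d2) => [|nu nuP s t l l' x s0 tT pl pl' ml ml']; first by rewrite lt_min d10.
have [q [pq lq l'q]] := common_refinement pl pl'.
have near' s1 t1 l1 y : 0 <= s1 -> t1 <= T -> t1 - s1 <= Num.min d1 d2 ->
    partition_of s1 t1 l1 -> `|chain nu s1 l1 y - nu t1 s1 y| <= C * (t1 - s1) `^ a.
  rewrite le_min => s10 t1T /andP[ts1 _] p1.
  by have [] := near nu nuP s1 t1 l1 s10 t1T ts1 p1.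
have rC' h : 0 <= h -> h <= Num.min d1 d2 -> C * h `^ a <= r * h.
  by rewrite le_min => h0 /andP[_]; apply: rC.
have ref l1 : partition_of s t l1 -> {subset l1 <= q} -> mesh_le (Num.min d1 d2) s l1 ->
    `|chain nu s q x - chain nu s l1 x| <= L * r * (t - s).
  by move=> p1 l1q m1; apply: (chain_refine nuP L0 s0 tT (Llip nu nuP) near' rC' p1 pq).
apply: le_trans (_ : L * r * (t - s) + L * r * (t - s) <= _).
  by apply: norm_triangle (ref l' pl' l'q ml'); rewrite distrC; apply: ref.
have st := partition_le pl.
have ts : L * r * (t - s) <= (L + 1) * r * T.
  have Lr : L * r <= (L + 1) * r by rewrite (ler_wpM2r (ltW r0)) // lerDl.
  apply: ler_pM Lr _; rewrite ?subr_ge0 ?(mulr_ge0 L0 (ltW r0)) //.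
  by clear -s0 tT; lra.
by move: ts; rewrite -[in X in _ -> X]rE; clear; lra.
Qed.

Definition fine_partition d s t : seq R :=
  xget [::] [set l | partition_of s t l /\ mesh_le d s l].

Lemma fine_partitionP d s t : 0 < d -> s <= t ->
  partition_of s t (fine_partition d s t) /\ mesh_le d s (fine_partition d s t).
Proof.
move=> d0 st.
have [l [pl ml _]] : exists l, [/\ partition_of s t l, mesh_le d s l &
    (size l <= (Num.truncn ((t - s) / d)).+1)%N].
  by apply: exists_partition => //; rewrite -ler_pdivrMr // ltW // truncnS_gt.
by apply: (@xgetPex _ [::] [set l | partition_of s t l /\ mesh_le d s l]); exists l.
Qed.

(** The choice of the partitions does not affect the limit, by [sewn_approx]. *)
Definition sewn nu t s x : E := lim (chain nu s (fine_partition n.+1%:R^-1 s t) x @[n --> \oo]).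

Lemma lim_close (f : nat -> E) (y : E) (K : R) : cvgn f ->
  (\forall n \near \oo, `|f n - y| <= K) -> `|limn f - y| <= K.
Proof.
move=> cf fK; apply/ler_addgt0Pr => e e0.
near \oo => n.
rewrite [K + e]addrC; apply: (@norm_triangle _ _ (f n)); last by near: n.
by apply: ltW; near: n; move/cvgrPdist_lt: cf; apply.
Unshelve. all: by end_near. Qed.

(** The mesh d is the same for all almost flows with the same constants, which is
    what makes the sewn flow depend continuously on nu. *)
Lemma sewn_approx T a g c e : 0 < T -> 1 < a -> 0 < g -> 0 <= c -> 0 < e ->
  exists2 d : R, 0 < d & forall nu, almost_flow T a g c nu ->
    forall s t l x, 0 <= s -> t <= T -> partition_of s t l ->
      mesh_le d s l -> `|sewn nu t s x - chain nu s l x| <= e.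
Proof.
move=> T0 a1 g0 c0 e0; have [d d0 Hd] := chain_cauchy T0 a1 g0 c0 e0.
exists d => // nu nuP s t l x s0 tT pl ml; have st := partition_le pl.
have inv0 n : 0 < n.+1%:R^-1 :> R by rewrite invr_gt0.
have small r : 0 < r -> \forall n \near \oo, n.+1%:R^-1 <= r :> R.
  move=> r0; exists (Num.truncn r^-1) => // n /= Nn; rewrite invf_ple ?posrE //.
  by apply: le_trans (ltW (truncnS_gt _)) _; rewrite ler_nat ltnS.
have part n := fine_partitionP (inv0 n) st.
apply: lim_close; last first.
  near=> n; have [pn mn] := part n.
  have nd : n.+1%:R^-1 <= d by near: n; apply: small.
  exact: (Hd nu nuP _ _ _ _ x s0 tT pn pl (mesh_mono nd mn) ml).
apply/cauchy_cvgP/cauchy_exP => r r0.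
have r20 : 0 < r / 2 by rewrite divr_gt0.
have [d' d'0 Hd'] := chain_cauchy T0 a1 g0 c0 r20.
have [N _ HN] := small d' d'0.
have [pN mN] := part N.
exists (chain nu s (fine_partition N.+1%:R^-1 s t) x).
exists N => // n /= Nn; rewrite -ball_normE /=; have [pn mn] := part n.
apply: le_lt_trans (_ : r / 2 < r); last by clear -r0; lra.
exact: (Hd' nu nuP _ _ _ _ x s0 tT pN pn (mesh_mono (HN N (leqnn N)) mN)
  (mesh_mono (HN n Nn) mn)).
Unshelve. all: by end_near. Qed.

End SewingLimit.

(** * The sewn flow *)

(** The preimage of z is the fixed point of the contraction
    x |-> z - (f x - x). *)
Lemma near_id_inverse (R : realType) (E : completeNormedModType R) (f : E -> E) :
  lip 2^-1 (fun x => f x - x) -> exists2 psi : E -> E,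
    cancel f psi /\ cancel psi f & lip 2 psi.
Proof.
move=> fl.
have expand x y : `|x - y| <= 2 * `|f x - f y|.
  have : `|x - y| <= `|f x - f y| + 2^-1 * `|x - y|.
    have := fl y x; rewrite (distrC y x); apply: normD_le (lexx _).
    by vring R.
  by clear; lra.
have /choice[psi psiK] : forall z, exists x, f x = z.
  move=> z; have q0 : 0 <= 2^-1 :> R by rewrite invr_ge0.
  pose q : {nonneg R} := NngNum q0.
  pose h : E -> E := fun x => z - (f x - x).
  have hfun : set_fun (@setT E) (@setT E) h by [].
  pose hF : {fun (@setT E) >-> (@setT E)} := HB.pack h (isFun.Build _ _ _ _ h hfun).
  have [|||x _ xh] := @banach_fixed_point R E setT hF.
  - exists q; split; first by rewrite /= invf_lt1 // ltr1n.
    move=> [x y] _ /=.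
    have -> : h x - h y = - (f x - x - (f y - y)) by rewrite /h; vring R.
    by rewrite normrN; apply: fl.
  - exact: closedT.
  - by exists 0.
  exists x; move: xh; rewrite /= /h => xh.
  by rewrite -[LHS](subrK x) [X in _ + X]xh addrC subrK.
exists psi; first split=> // x; last first.
  by move=> x y; apply: le_trans (expand _ _) _; rewrite !psiK.
by apply/eqP; rewrite -subr_eq0 -normr_le0; have := expand (psi (f x)) x; rewrite psiK subrr normr0 mulr0.
Qed.

Section SewnFlow.
Variables (R : realType) (E : completeNormedModType R).
Implicit Types (nu : R -> R -> E -> E) (T a g c e s t u v d : R) (l : seq R) (x y : E).

Lemma sewn_lip T a g c : 0 < T -> 1 < a -> 0 < g -> 0 <= c -> exists2 L : R, 0 <= L &
  forall nu, almost_flow T a g c nu -> forall s t, 0 <= s -> s <= t -> t <= T ->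
    lip L (sewn nu t s).
Proof.
move=> T0 a1 g0 c0; have [L L0 HL] := @chain_lip _ E T _ _ _ a1 g0 c0.
exists L => // nu nuP s t s0 st tT x y.
apply: (@le_of_le_mul_eps _ _ _ 2) => // e e0.
have [d d0 Hd] := @sewn_approx _ E _ _ _ _ _ T0 a1 g0 c0 e0.
have [pl ml] := fine_partitionP d0 st.
have Hx z := Hd nu nuP s t _ z s0 tT pl ml.
have := norm_triangle (Hx x) (norm_triangle (HL nu nuP s t _ s0 tT pl x y)
  (eq_ind_r (fun r => r <= e) (Hx y) (distrC _ _))).
by clear; lra.
Qed.

Lemma sewn_near T a g c : 0 < T -> 1 < a -> 0 < g -> 0 <= c -> exists C d : R,
  [/\ 0 <= C, 0 < d & forall nu, almost_flow T a g c nu ->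
    forall s t, 0 <= s -> s <= t -> t <= T -> t - s <= d ->
      (forall x, `|sewn nu t s x - nu t s x| <= C * (t - s) `^ a) /\
      lip 2^-1 (fun x => sewn nu t s x - x)].
Proof.
move=> T0 a1 g0 c0; have [C [d [C0 d0 Cd near]]] := chain_near E T a1 g0 c0.
exists C, d; split=> // nu nuP s t s0 st tT ts.
have approx e : 0 < e -> exists2 l, partition_of s t l &
    forall x, `|sewn nu t s x - chain nu s l x| <= e.
  move=> e0; have [d' d'0 Hd] := @sewn_approx _ E _ _ _ _ _ T0 a1 g0 c0 e0.
  have [pl ml] := fine_partitionP d'0 st.
  by exists (fine_partition d' s t) => // x; apply: (Hd nu nuP _ _ _ _ s0 tT pl ml).
split=> [x|x y]; apply: (@le_of_le_mul_eps _ _ _ 2) => // e e0; have [l pl Hl] := approx e e0.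
  have [H _] := near nu nuP s t l s0 tT ts pl.
  have := norm_triangle (Hl x) (H x); clear -e0; lra.
have [_ H] := near nu nuP s t l s0 tT ts pl.
have ts0 : 0 <= t - s by rewrite subr_ge0.
have E1 := normD_le erefl (H x y) (af_lip nuP s0 st tT x y).
have E2 := normD_le erefl (Hl x) (eq_ind_r (fun r => r <= e) (Hl y) (distrC _ _)).
have := normD_le erefl E1 E2.
rewrite [X in `|X| <= _ -> _](_ : _ = sewn nu t s x - x - (sewn nu t s y - y)); last by vring R.
move/le_trans; apply; rewrite -mulrDl; apply: lerD; last by clear; lra.
by rewrite ler_wpM2r // addrC Cd.
Qed.

Lemma sewn_is_flow T a g c nu : 0 < T -> 1 < a -> 0 < g -> 0 <= c ->
  almost_flow T a g c nu -> is_flow T (sewn nu).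
Proof.
move=> T0 a1 g0 c0 nuP; have [L L0 HL] := @sewn_lip T a g c T0 a1 g0 c0.
split=> [t t0 tT|s u t s0 su ut tT]; apply/funext => x.
  apply/eqP; rewrite -subr_eq0 -normr_le0; apply/ler_addgt0Pr => e e0.
  have [d d0 Hd] := @sewn_approx _ E _ _ _ _ _ T0 a1 g0 c0 e0.
  by rewrite add0r; apply: (Hd nu nuP _ _ [::]).
apply/eqP; rewrite -subr_eq0 -normr_le0; apply: (@le_of_le_mul_eps _ _ _ (2 + L)).
  by rewrite addr_ge0.
move=> e e0; have [d d0 Hd] := @sewn_approx _ E _ _ _ _ _ T0 a1 g0 c0 e0.
have [p1 m1] := fine_partitionP d0 su; have [p2 m2] := fine_partitionP d0 ut.
have u0 := le_trans s0 su; have uT := le_trans ut tT.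
have H := Hd nu nuP s t _ x s0 tT (partition_cat p1 p2) (mesh_cat p1 m1 m2).
rewrite chain_cat (proj2 p1) in H.
have H2 := Hd nu nuP u t _ (chain nu s (fine_partition d s u) x) u0 tT p2 m2.
rewrite distrC in H2.
have H1 := Hd nu nuP s u _ x s0 uT p1 m1; rewrite distrC in H1.
have H3 := le_trans (HL nu nuP u t u0 ut tT _ _) (ler_wpM2l L0 H1).
have := norm_triangle H (norm_triangle H2 H3) => /=; clear; lra.
Qed.

(** The distance between y and the chain is a telescopic sum of the errors made
    over the steps of the partition, each multiplied by the Lipschitz constant of
    the remaining steps. *)
Lemma chain_track nu (y : R -> E) s0 t d r (L : R) s l : 0 <= L -> 0 <= s0 ->
  (forall s l, 0 <= s -> partition_of s t l -> lip L (chain nu s l)) ->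
  (forall u v, s0 <= u -> u <= v -> v <= t -> v - u <= d ->
     `|y v - nu v u (y u)| <= r * (v - u)) ->
  s0 <= s -> partition_of s t l -> mesh_le d s l ->
  `|y t - chain nu s l (y s)| <= L * r * (t - s).
Proof.
move=> L0 s00 HL Hy; elim: l s => [|u l IHl] s s0s [pl lt] ml.
  by move: lt => /= <-; rewrite !subrr normr0 mulr0.
move: pl lt ml => /= /andP[/ltW su pl] lt /andP[du ml].
have ut : u <= t by rewrite -lt; apply: path_le_last.
have s0u := le_trans s0s su.
rewrite (_ : _ * (t - s) = L * r * (t - u) + L * (r * (u - s))); last by ring.
apply: norm_triangle (IHl u s0u (conj pl lt) ml) _.
apply: le_trans (HL u l (le_trans s00 s0u) (conj pl lt) _ _) _.
by rewrite ler_wpM2l // Hy.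
Qed.

(** A path which follows nu up to o(h) over every time step of length h is a
    trajectory of the sewn flow. *)
Lemma sewn_track T a g c nu (y : R -> E) s t : 0 < T -> 1 < a -> 0 < g -> 0 <= c ->
  almost_flow T a g c nu -> 0 <= s -> s <= t -> t <= T ->
  (forall e, 0 < e -> exists2 d, 0 < d & forall u v, s <= u -> u <= v -> v <= t ->
     v - u <= d -> `|y v - nu v u (y u)| <= e * (v - u)) ->
  y t = sewn nu t s (y s).
Proof.
move=> T0 a1 g0 c0 nuP s0 st tT Hy.
have [L L0 HL] := @chain_lip _ E T _ _ _ a1 g0 c0.
apply/eqP; rewrite -subr_eq0 -normr_le0; apply: (@le_of_le_mul_eps _ _ _ (L * (t - s) + 1)).
  by rewrite addr_ge0 // mulr_ge0 // subr_ge0.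
move=> e e0; rewrite add0r.
have [d1 d10 H1] := @sewn_approx _ E _ _ _ _ _ T0 a1 g0 c0 e0.
have [d2 d20 H2] := Hy e e0.
have d0 : 0 < Num.min d1 d2 by rewrite lt_min d10.
have [pl ml] := fine_partitionP d0 st; set l := fine_partition _ s t in pl ml.
have m1 : mesh_le d1 s l by apply: mesh_mono ml; rewrite ge_min lexx.
have m2 : mesh_le d2 s l by apply: mesh_mono ml; rewrite ge_min lexx orbT.
have Hl : `|y t - chain nu s l (y s)| <= L * e * (t - s).
  by apply: (chain_track L0 s0 _ H2) => // s' l' s'0; apply: HL.
have := H1 nu nuP s t l (y s) s0 tT pl m1; rewrite distrC => H3.
by have := norm_triangle Hl H3; clear; lra.
Qed.

Lemma chain_dist nu nu' t r (L : R) s l x : 0 <= L -> 0 <= s ->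
  (forall s l, 0 <= s -> partition_of s t l -> lip L (chain nu s l)) ->
  (forall u v x, 0 <= u -> u <= v -> v <= t -> `|nu v u x - nu' v u x| <= r) ->
  partition_of s t l -> `|chain nu s l x - chain nu' s l x| <= (size l)%:R * (L * r).
Proof.
move=> L0 s0 HL Hr; elim: l s x s0 => [|u l IHl] s x s0 [pl lt].
  by rewrite subrr normr0 mul0r.
move: pl lt => /= /andP[/ltW su pl] lt.
have ut : u <= t by rewrite -lt; apply: path_le_last.
have u0 := le_trans s0 su.
rewrite (_ : _ * (L * r) = L * r + (size l)%:R * (L * r)); last by rewrite -natr1; ring.
apply: norm_triangle (IHl u _ u0 (conj pl lt)).
apply: le_trans (HL u l u0 (conj pl lt) _ _) _.
by rewrite ler_wpM2l // Hr.
Qed.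

(** Over a fixed partition the two chains are close, and the error made by
    replacing the flows by chains is uniform over all almost flows with the
    same constants. *)
Lemma sewn_continuous T a g c e : 0 < T -> 1 < a -> 0 < g -> 0 <= c -> 0 < e ->
  exists2 r : R, 0 < r & forall nu nu', almost_flow T a g c nu -> almost_flow T a g c nu' ->
    (forall s t x, 0 <= s -> s <= t -> t <= T -> `|nu t s x - nu' t s x| <= r) ->
    forall s t x, 0 <= s -> s <= t -> t <= T -> `|sewn nu t s x - sewn nu' t s x| <= e.
Proof.
move=> T0 a1 g0 c0 e0; have [L L0 HL] := @chain_lip _ E T _ _ _ a1 g0 c0.
have e30 : 0 < e / 3 by rewrite divr_gt0.
have [d d0 Hd] := @sewn_approx _ E _ _ _ _ _ T0 a1 g0 c0 e30.
pose k := (Num.truncn (T / d)).+1.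
have Tk : T <= k%:R * d by rewrite -ler_pdivrMr // ltW // truncnS_gt.
pose K : R := k%:R * L + 1.
have kL0 : 0 <= k%:R * L by rewrite mulr_ge0.
have K0 : 0 < K by rewrite /K ltr_wpDl.
exists (e / 3 / K) => [|nu nu' nuP nu'P Hr s t x s0 st tT]; first by rewrite divr_gt0.
have [l [pl ml sl]] : exists l, [/\ partition_of s t l, mesh_le d s l & (size l <= k)%N].
  by apply: exists_partition => //; apply: le_trans Tk; clear -s0 tT; lra.
have H1 := Hd nu nuP s t l x s0 tT pl ml.
have H2 := Hd nu' nu'P s t l x s0 tT pl ml; rewrite distrC in H2.
have r0 : 0 <= e / 3 / K by rewrite divr_ge0 // ltW.
have H3 : `|chain nu s l x - chain nu' s l x| <= (size l)%:R * (L * (e / 3 / K)).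
  apply: (@chain_dist nu nu' t) => // [s' l' s'0|u v z u0 uv vt]; first exact: HL.
  by apply: Hr => //; apply: le_trans vt tT.
have H4 : (size l)%:R * (L * (e / 3 / K)) <= e / 3.
  apply: le_trans (_ : k%:R * L * (e / 3 / K) <= _).
    by rewrite -[leRHS]mulrA ler_wpM2r ?ler_nat // mulr_ge0.
  rewrite mulrCA ger_pMr // ler_pdivrMr // mul1r /K; lra.
have := norm_triangle H1 (norm_triangle (le_trans H3 H4) H2).
by clear; lra.
Qed.

(** Short time steps are invertible by [near_id_inverse], and any time step is
    composed of about T / d of them. *)
Lemma sewn_inverse T a g c : 0 < T -> 1 < a -> 0 < g -> 0 <= c -> exists2 L : R, 0 <= L &
  forall nu, almost_flow T a g c nu -> forall s t, 0 <= s -> s <= t -> t <= T ->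
    exists2 psi : E -> E, cancel (sewn nu t s) psi /\ cancel psi (sewn nu t s) & lip L psi.
Proof.
move=> T0 a1 g0 c0; have [C [d [C0 d0 near]]] := sewn_near T0 a1 g0 c0.
pose k := (Num.truncn (T / d)).+1.
have Tk : T <= k%:R * d by rewrite -ler_pdivrMr // ltW // truncnS_gt.
exists (2 ^+ k) => [|nu nuP s t s0 st tT]; first by rewrite exprn_ge0.
have [phi_id phi_comp] := sewn_is_flow T0 a1 g0 c0 nuP.
have : t - s <= k%:R * d by apply: le_trans Tk; clear -s0 tT; lra.
elim: k s s0 st {Tk} => [|k IHk] s s0 st ts.
  have -> : s = t by apply/eqP; rewrite eq_le st -subr_le0 -(mul0r d).
  exists id; last by rewrite expr0; exact: lip_id.
  by rewrite phi_id // (le_trans s0).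
have [u [su ut us tu]] : exists u, [/\ s <= u, u <= t, u - s <= d & t - u <= k%:R * d].
  have [td|dt] := leP (t - s) d.
    by exists t; split=> //; rewrite subrr mulr_ge0 // ltW.
  exists (s + d); rewrite -natr1 mulrDl mul1r in ts.
  by split; clear -ts dt d0; lra.
have u0 := le_trans s0 su; have uT := le_trans ut tT.
have [psi2 [K2 K2'] L2] := IHk u u0 ut tu.
have [_ l1] := near nu nuP s u s0 su uT us.
have [psi1 [K1 K1'] L1] := near_id_inverse l1.
exists (psi1 \o psi2); last by rewrite exprS; apply: lip_comp.
by rewrite (phi_comp s u t) //; split; apply: can_comp.
Qed.

End SewnFlow.

(** * Autonomous differential equations *)

Section Ode.
Variables (R : realType) (E : completeNormedModType R).
Implicit Types (W f : E -> E) (x : E) (M n K : R).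

(** The four points are x + N x, x, y + N y and y; a small displacement N makes
    both factors of the bound small. *)
Lemma lip_shift K n f (N : E -> E) : 0 <= K -> four_point K f -> bdd n N -> lip n N ->
  lip (K * (n * (3 + n))) (fun x => f (x + N x) - f x).
Proof.
move=> K0 ff Nb Nl x y; apply: le_trans (ff _ _ _ _) _; rewrite -mulrA ler_wpM2l //.
have n0 : 0 <= n by apply: le_trans (Nb x).
have E1 : `|x + N x - (y + N y)| <= `|x - y| + n * `|x - y|.
  by apply: normD_le (lexx _) (Nl x y); vring R.
have E2 : `|x + N x - x - (y + N y - y)| <= n * `|x - y|.
  by rewrite [X in `|X|](_ : _ = N x - N y); last by vring R.
have E3 : `|x + N x - x| <= n by rewrite [X in `|X|](_ : _ = N x); last by vring R.
apply: le_trans (_ : n * `|x - y| + n * (`|x - y| + n * `|x - y| + `|x - y|) <= _).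
  by apply: lerD E2 _; apply: ler_pM E3 _; rewrite ?addr_ge0 // lerD.
by rewrite le_eqVlt; apply/orP; left; apply/eqP; ring.
Qed.

Definition euler W (t s : R) x : E := x + (t - s) *: W x.

Lemma euler_almost_flow M W : C11 M W ->
  almost_flow 1 2 1 (M + M ^+ 2 * (3 + M)) (euler W).
Proof.
move=> WM; have M0 := C11_ge0 WM; have [Wb Wl Wf] := WM.
set c := M + _.
have Mc : M <= c by rewrite lerDl mulr_ge0 ?sqr_ge0 // addr_ge0.
have M2c : M ^+ 2 * (3 + M) <= c by rewrite lerDr.
have euE t s x : euler W t s x - x = (t - s) *: W x by rewrite /euler addrC addKr.
have CE s t : s <= t -> C11 (c * (t - s) `^ 1) (fun x => euler W t s x - x).
  move=> st; rewrite powRr1 ?subr_ge0 // mulrC.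
  rewrite (_ : (fun x => _) = fun x => (t - s) *: W x); last by apply/funext => x.
  by apply: C11_scale; [rewrite ger0_norm ?subr_ge0|apply: C11_le WM].
have defE s u t x : euler W t u (euler W u s x) - euler W t s x
    = (t - u) *: (W (x + (u - s) *: W x) - W x) by rewrite /euler; vring R.
have hh s u t : s <= u -> u <= t -> (t - u) * (u - s) <= (t - s) `^ 2.
  move=> su ut; rewrite powR_mulrn ?subr_ge0 ?(le_trans su) //; nra.
split=> [s x _ _|s t s0 st t1|s t s0 st t1|s u t x s0 su ut t1|s u t s0 su ut t1].
- by rewrite /euler subrr scale0r addr0.
- exact: C11_lip (CE s t st).
- exact: C11_four (CE s t st).
- rewrite defE; have tu : `|t - u| <= t - u by rewrite ger0_norm ?subr_ge0.
  have us : `|(u - s) *: W x| <= (u - s) * M by apply: normZ_le; rewrite ?ger0_norm ?subr_ge0.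
  have HW : `|W (x + (u - s) *: W x) - W x| <= M * ((u - s) * M).
    by apply: le_trans (Wl _ _) _; rewrite (addrC x) addrK ler_wpM2l.
  apply: le_trans (normZ_le tu HW) _.
  rewrite (_ : _ * _ = M ^+ 2 * ((t - u) * (u - s))); last by ring.
  apply: ler_pM; rewrite ?sqr_ge0 ?mulr_ge0 ?subr_ge0 ?hh //.
  by apply: le_trans M2c; rewrite ler_peMr ?sqr_ge0 //; clear -M0; lra.
- move=> x y; rewrite !defE -scalerBr.
  have h0 : 0 <= u - s by rewrite subr_ge0.
  have h1 : u - s <= 1 by clear -s0 ut t1; lra.
  have NC := C11_scale (_ : `|u - s| <= u - s) WM.
  have {}NC : C11 ((u - s) * M) (fun x => (u - s) *: W x) by apply: NC; rewrite ger0_norm.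
  have tu : `|t - u| <= t - u by rewrite ger0_norm ?subr_ge0.
  apply: le_trans (normZ_le tu (lip_shift M0 Wf (C11_bdd NC) (C11_lip NC) x y)) _.
  rewrite mulrA ler_wpM2r //.
  apply: le_trans (_ : M ^+ 2 * (3 + M) * ((t - u) * (u - s)) <= _).
    rewrite (_ : _ * (M * _) = M ^+ 2 * (3 + (u - s) * M) * ((t - u) * (u - s))); last by ring.
    rewrite ler_wpM2r ?mulr_ge0 ?subr_ge0 // ler_wpM2l ?sqr_ge0 // lerD2l.
    by rewrite ler_piMl.
  by apply: ler_pM; rewrite ?hh ?mulr_ge0 ?sqr_ge0 ?subr_ge0 ?addr_ge0.
Qed.

Lemma ode_solution_deriv W x (y : R -> E) : ode_solution W x y ->
  deriv_within 0 1 y (fun u => W (y u)).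
Proof.
move=> [_ Hy] u /andP[u0 u1] e e0.
have /cvgrPdist_le/(_ e e0) := Hy u u0 u1.
rewrite !near_withinE => /nbhs_ballP[d /= d0 Hd].
exists (d / 2) => [|v /andP[v0 v1] vu]; first by rewrite divr_gt0.
have [->|uv] := eqVneq v u; first by rewrite !subrr scale0r subrr !normr0 mulr0.
have vu0 : v - u != 0 by rewrite subr_eq0.
have := Hd v; rewrite -ball_normE /= distrC => /(_ _ uv _).
have -> : `|v - u| < d by apply: le_lt_trans vu _; clear -d0; lra.
rewrite in_itv /= v0 v1 => /(_ isT isT) H.
rewrite (_ : y v - y u - _ = - ((v - u) *: (W (y u) - (v - u)^-1 *: (y v - y u)))).
  by rewrite normrN normrZ mulrC ler_wpM2r.
rewrite scalerBr scalerA divff // scale1r; vring R.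
Qed.

Lemma deriv_ode_solution W x (y : R -> E) : y 0 = x ->
  deriv_within 0 1 y (fun u => W (y u)) -> ode_solution W x y.
Proof.
move=> y0 Hy; split=> // u u0 u1; apply/cvgrPdist_le => e e0.
have u01 : 0 <= u <= 1 by rewrite u0.
have [d d0 Hd] := Hy u u01 e e0.
rewrite !near_withinE; apply/nbhs_ballP; exists d => // v.
rewrite -ball_normE /= distrC => vd uv; rewrite in_itv /= => v01.
have vu0 : v - u != 0 by rewrite subr_eq0.
have := Hd v v01 (ltW vd).
rewrite (_ : y v - y u - _ = - ((v - u) *: (W (y u) - (v - u)^-1 *: (y v - y u)))).
  by rewrite normrN normrZ mulrC ler_pM2r // normr_gt0.
rewrite scalerBr scalerA divff // scale1r; vring R.
Qed.

Lemma ode_solution_growth M W x (y : R -> E) u v : bdd M W -> ode_solution W x y ->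
  0 <= u -> u <= v -> v <= 1 -> `|y v - y u| <= M * (v - u).
Proof.
move=> Wb /ode_solution_deriv Dy u0 uv v1.
exact: mean_value uv (deriv_within_sub u0 v1 Dy) (fun _ _ => Wb _).
Qed.

(** The derivative of y v - v W(y u) in v is W(y v) - W(y u), which is of the
    order of v - u because W o y is Lipschitz. *)
Lemma ode_solution_euler M W x (y : R -> E) u v : C11 M W -> ode_solution W x y ->
  0 <= u -> u <= v -> v <= 1 -> `|y v - euler W v u (y u)| <= M ^+ 2 * (v - u) ^+ 2.
Proof.
move=> WM ysol u0 uv v1; have M0 := C11_ge0 WM; have [Wb Wl _] := WM.
have Dy := deriv_within_sub u0 v1 (ode_solution_deriv ysol).
have D := deriv_within_lin 1 (-1) Dy (@deriv_within_affine _ _ u v 0 (W (y u))).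
have := mean_value (M := M ^+ 2 * (v - u)) uv D.
rewrite [X in `|X|](_ : _ = y v - euler W v u (y u)); last by rewrite /euler; vring R.
rewrite -mulrA -expr2; apply => w /andP[uw wv].
rewrite [X in `|X|](_ : _ = W (y w) - W (y u)); last by vring R.
apply: le_trans (Wl _ _) _; rewrite expr2 -mulrA ler_wpM2l //.
have /le_trans := ode_solution_growth Wb ysol u0 uw (le_trans wv v1); apply.
by rewrite ler_wpM2l // lerB.
Qed.

(** Existence and uniqueness are both read off the sewn Euler scheme: its
    trajectories are solutions, and every solution follows the scheme up to
    O(h^2) over a time step h. *)
Lemma time1_map_euler M W : C11 M W -> time1_map W (sewn (euler W) 1 0).
Proof.
move=> WM; have M0 := C11_ge0 WM; have [Wb Wl _] := WM.
have af := euler_almost_flow WM; set c := (X in almost_flow _ _ _ X) in af.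
have c0 : 0 <= c by rewrite addr_ge0 ?mulr_ge0 ?sqr_ge0 ?addr_ge0.
have lt12 : (1 : R) < 2 by rewrite ltr1n.
move=> x z; split=> [<-|[y [ysol <-]]]; last first.
  rewrite (sewn_track (y := y) (s := 0) ltr01 lt12 ltr01 c0 af) //.
    by rewrite (proj1 ysol).
  move=> e e0; exists (e / (M ^+ 2 + 1)) => [|u v u0 uv v1].
    by rewrite divr_gt0 // ltr_wpDl // sqr_ge0.
  rewrite ler_pdivlMr ?ltr_wpDl ?sqr_ge0 // => vu.
  apply: le_trans (ode_solution_euler WM ysol u0 uv v1) _.
  rewrite expr2 mulrA ler_wpM2r ?subr_ge0 //; apply: le_trans vu.
  by rewrite mulrC ler_wpM2l ?subr_ge0 // lerDl.
have [C [d [C0 d0 near]]] := @sewn_near _ E _ _ _ _ ltr01 lt12 ltr01 c0.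
have [phi_id phi_comp] := sewn_is_flow ltr01 lt12 ltr01 c0 af.
exists (fun u => sewn (euler W) u 0 x); split=> //.
apply: deriv_ode_solution; first by rewrite phi_id.
set y := fun u => sewn _ u 0 x.
have fwd u v : 0 <= u -> u <= v -> v <= 1 -> v - u <= d ->
    `|y v - y u - (v - u) *: W (y u)| <= C * (v - u) ^+ 2.
  move=> u0 uv v1 vu; have [H _] := near _ af u v u0 uv v1 vu.
  have := H (y u); rewrite powR_mulrn ?subr_ge0 //.
  by rewrite /y (phi_comp 0 u v) //= /euler opprD addrA.
have growth u v : 0 <= u -> u <= v -> v <= 1 -> v - u <= d ->
    `|y v - y u| <= (C + M) * (v - u).
  move=> u0 uv v1 vu; rewrite mulrDl.
  have vu0 : 0 <= v - u by rewrite subr_ge0.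
  apply: (@normD_le _ _ _ _ _ (y v - y u - (v - u) *: W (y u)) ((v - u) *: W (y u))).
  - by rewrite subrK.
  - apply: le_trans (fwd u v u0 uv v1 vu) _; rewrite ler_wpM2l // expr2 ler_piMl //.
    by clear -u0 v1; lra.
  - by rewrite mulrC; apply: normZ_le; rewrite ?ger0_norm.
pose K : R := C + M * (C + M).
have K0 : 0 <= K by rewrite addr_ge0 // mulr_ge0 // addr_ge0.
have both u v : 0 <= u <= 1 -> 0 <= v <= 1 -> `|v - u| <= d ->
    `|y v - y u - (v - u) *: W (y u)| <= K * `|v - u| ^+ 2.
  move=> /andP[u0 u1] /andP[v0 v1]; have [uv|/ltW vu] := leP u v.
    rewrite ger0_norm ?subr_ge0 // => vu; apply: le_trans (fwd u v u0 uv v1 vu) _.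
    by rewrite ler_wpM2r ?sqr_ge0 // lerDl mulr_ge0 // addr_ge0.
  rewrite distrC (ger0_norm (_ : 0 <= u - v)) ?subr_ge0 // => uvd.
  have H1 := fwd v u v0 vu u1 uvd.
  have H2 : `|(u - v) *: (W (y u) - W (y v))| <= (u - v) * (M * ((C + M) * (u - v))).
    apply: normZ_le; first by rewrite ger0_norm ?subr_ge0.
    by apply: le_trans (Wl _ _) _; rewrite ler_wpM2l // growth.
  rewrite (_ : K * _ = C * (u - v) ^+ 2 + (u - v) * (M * ((C + M) * (u - v)))); last first.
    by rewrite /K; ring.
  rewrite -normrN in H1; apply: normD_le H1 H2; vring R.
move=> u u01 e e0; exists (Num.min d (e / (K + 1))) => [|v v01].
  by rewrite lt_min d0 divr_gt0 // ltr_wpDl.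
rewrite le_min => /andP[vd]; rewrite ler_pdivlMr ?ltr_wpDl // => ve.
apply: le_trans (both u v u01 v01 vd) _; rewrite expr2 mulrA ler_wpM2r //.
by apply: le_trans ve; rewrite mulrC ler_wpM2l // lerDl.
Qed.

(** A Taylor expansion whose error is cubic in n when k is of the order of n^2:
    y u - x is of order n, hence y u - x - u G(x) of order n^2, and the
    derivative of y u - x - u (G(x) + K(x)) - (u^2 / 2) DG(x) G(x) of order
    n^3. *)
Lemma ode_solution_expansion (n k : R) (G K : E -> E) (DG : E -> E -> E) x (y : R -> E) :
  0 <= n -> 0 <= k -> bdd n G -> lip n G -> bdd k K -> lip k K ->
  (forall x v, `|DG x v| <= n * `|v|) ->
  (forall x v w (r : R), DG x (v - r *: w) = DG x v - r *: DG x w) ->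
  (forall x v, `|G (x + v) - G x - DG x v| <= n * `|v| ^+ 2) ->
  ode_solution (fun z => G z + K z) x y ->
  `|y 1 - (x + G x + K x + 2^-1 *: DG x (G x))|
  <= n * (n + k) ^+ 2 + n * (n * (n + k) + k) + k * (n + k).
Proof.
move=> n0 k0 Gb Gl Kb Kl Db Dl DT ysol.
have nk0 : 0 <= n + k by rewrite addr_ge0.
have Wb : bdd (n + k) (fun z => G z + K z) by move=> z; apply: normD_le (Gb z) (Kb z).
have y0 := proj1 ysol.
have Dy := ode_solution_deriv ysol.
have gr u : 0 <= u <= 1 -> `|y u - x| <= n + k.
  move=> /andP[u0 u1]; have := ode_solution_growth Wb ysol (lexx 0) u0 u1.
  by rewrite y0 subr0 => /le_trans; apply; rewrite ler_piMr.
have gr1 u : 0 <= u <= 1 -> `|y u - x - u *: G x| <= n * (n + k) + k.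
  move=> /andP[u0 u1].
  have Dy' := deriv_within_sub (lexx 0) u1 Dy.
  have D := deriv_within_lin 1 (-1) Dy' (@deriv_within_affine _ _ 0 u 0 (G x)).
  have := mean_value (M := n * (n + k) + k) u0 D.
  rewrite [X in `|X|](_ : _ = y u - x - u *: G x); last by rewrite y0; vring R.
  move=> H; apply: le_trans (H _) _; last first.
    by rewrite subr0 ler_piMr // addr_ge0 // mulr_ge0.
  move=> w /andP[w0 wu]; apply: (@normD_le _ _ _ _ _ (G (y w) - G x) (K (y w))) => //.
    by vring R.
  apply: le_trans (Gl _ _) _; rewrite ler_wpM2l // gr // w0 /=; exact: le_trans u1.
have D1 := deriv_within_lin 1 (-1) Dy (@deriv_within_affine _ _ 0 1 x (G x + K x)).
have D := deriv_within_lin 1 (-1) D1 (@deriv_within_quadratic _ _ 0 1 (DG x (G x))).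
pose B : R := n * (n + k) ^+ 2 + n * (n * (n + k) + k) + k * (n + k).
have := mean_value (M := B) ler01 D; rewrite subr0 mulr1.
rewrite [X in `|X|](_ : _ = y 1 - (x + G x + K x + 2^-1 *: DG x (G x))); last first.
  rewrite y0; vring R.
apply => u u01.
rewrite [X in `|X|](_ : _ = G (x + (y u - x)) - G x - DG x (y u - x)
   + DG x (y u - x - u *: G x) + (K (y u) - K x)); last first.
  by rewrite subrKC Dl; vring R.
apply: normD_le erefl (normD_le erefl _ _) _.
- apply: le_trans (DT _ _) _; rewrite ler_wpM2l // lerXn2r ?nnegrE // gr //.
- by apply: le_trans (Db _ _) _; rewrite ler_wpM2l // gr1.
- by apply: le_trans (Kl _ _) _; rewrite ler_wpM2l // gr.
Qed.

End Ode.

(** * The Davie scheme *)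

Section BoundedLipschitz.
Variables (R : realType) (E : normedModType R).
Implicit Types (f g : E -> E) (M N : R).

Definition bdd_lip M f := bdd M f /\ lip M f.

Lemma bdd_lip_le M N f : M <= N -> bdd_lip M f -> bdd_lip N f.
Proof. by move=> MN [fb fl]; split; [move=> x; apply: le_trans (fb x) MN|apply: lip_le fl]. Qed.

Lemma bdd_lip_ext M f g : (forall x, f x = g x) -> bdd_lip M f -> bdd_lip M g.
Proof. by move=> fg; rewrite (_ : g = f) //; apply/funext => x. Qed.

Lemma C11_bdd_lip M f : C11 M f -> bdd_lip M f.
Proof. by case. Qed.

Lemma bdd_lip_add M N f g : bdd_lip M f -> bdd_lip N g -> bdd_lip (M + N) (fun x => f x + g x).
Proof.
move=> [fb fl] [gb gl]; split=> [x|x y]; first exact: normD_le (fb x) (gb x).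
rewrite mulrDl; apply: normD_le (fl x y) (gl x y); vring R.
Qed.

Lemma bdd_lip_scale M (k m : R) f : `|k| <= m -> bdd_lip M f -> bdd_lip (m * M) (fun x => k *: f x).
Proof.
move=> km [fb fl]; split=> [x|x y]; first exact: normZ_le (fb x).
by rewrite -scalerBr -mulrA; apply: normZ_le (fl x y).
Qed.

Lemma bdd_lip_sum (I : finType) M (f : I -> E -> E) :
  (forall i, bdd_lip M (f i)) -> bdd_lip (#|I|%:R * M) (fun x => \sum_i f i x).
Proof.
move=> H; rewrite cardE -deprecated_filter_index_enum filter_predT.
elim: (index_enum I) => [|i s IHs] /=.
  by split=> [x|x y]; rewrite !big_nil ?subrr normr0 mul0r ?mul0r.
rewrite (_ : (fun=> _) = fun x => f i x + \sum_(j <- s) f j x).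
  by rewrite -addn1 natrD mulrDl mul1r addrC; apply: bdd_lip_add.
by apply/funext => x; rewrite big_cons.
Qed.

End BoundedLipschitz.

Section Davie.
Variables (R : realType) (E : completeNormedModType R) (l : nat).
Variables (V : E -> E) (F : 'I_l -> E -> E).
Implicit Types (x : E) (h : R) (u v : 'rV[R]_l) (m : 'M[R]_l) (X : rough_data R l).

(** The operator F_j F_k applied to the identity of E. *)
Definition field2 (j k : 'I_l) x : E := 'd (F k) x (F j x).

Definition davie_incr h u m x : E := h *: V x + (\sum_i u 0 i *: F i x
  + \sum_j \sum_k m j k *: field2 j k x).

(** The bracket term and the second order Taylor term of mu_ts are merged into
    the single sum over rp2 X t s; see [rde_field_davie]. *)
Definition davie X (t s : R) x : E := x + davie_incr (t - s) (rp1 X t s) (rp2 X t s) x.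

Lemma rV_norm_ge u i : `|u 0 i| <= `|u|.
Proof. by rewrite [leRHS]/Num.norm /= mx_normrE; apply/bigmax_geP; right => /=; exists (0, i). Qed.

Lemma mx_norm_ge m j k : `|m j k| <= `|m|.
Proof. by rewrite [leRHS]/Num.norm /= mx_normrE; apply/bigmax_geP; right => /=; exists (j, k). Qed.

Lemma davie_incrD h h' u u' m m' x :
  davie_incr (h + h') (u + u') (m + m') x = davie_incr h u m x + davie_incr h' u' m' x.
Proof.
rewrite /davie_incr.
have -> : \sum_i (u + u') 0 i *: F i x = \sum_i u 0 i *: F i x + \sum_i u' 0 i *: F i x.
  by rewrite -big_split; apply: eq_bigr => i _; rewrite mxE scalerDl.
have -> : \sum_j \sum_k (m + m') j k *: field2 j k x =
    \sum_j \sum_k m j k *: field2 j k x + \sum_j \sum_k m' j k *: field2 j k x.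
  rewrite -big_split; apply: eq_bigr => j _; rewrite -big_split.
  by apply: eq_bigr => k _; rewrite mxE scalerDl.
vring R.
Qed.

Lemma davie_incrZ (k : R) h u m x :
  davie_incr (k * h) (k *: u) (k *: m) x = k *: davie_incr h u m x.
Proof.
rewrite /davie_incr !scalerDr scalerA !scaler_sumr; congr (_ + (_ + _)).
  by apply: eq_bigr => i _; rewrite mxE scalerA.
apply: eq_bigr => j _; rewrite scaler_sumr; apply: eq_bigr => i _.
by rewrite mxE scalerA.
Qed.

Lemma davie_incr_first u x : davie_incr 0 u 0 x = \sum_i u 0 i *: F i x.
Proof.
rewrite /davie_incr scale0r add0r [X in _ + X]big1 ?addr0 // => j _.
by rewrite big1 // => k _; rewrite mxE scale0r.
Qed.

(** The tensor term of Chen's relation is the derivative of the increment of the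
    later step in the direction of the first level of the earlier one. *)
Lemma davie_incr_tensor u v x : davie_incr 0 0 (tensor u v) x
  = \sum_k v 0 k *: 'd (F k) x (\sum_j u 0 j *: F j x).
Proof.
rewrite /davie_incr scale0r add0r big1 ?add0r => [|i _]; last by rewrite mxE scale0r.
rewrite exchange_big /=; apply: eq_bigr => k _; rewrite linear_sum scaler_sumr.
apply: eq_bigr => j _; rewrite linearZ scalerA /tensor !mxE big_ord1 !mxE mulrC.
by [].
Qed.

(** The first order part of F_k(x + I) - F_k(x), in the direction of the
    first level of the increment I, is removed by the tensor term; the rest is of
    third order. *)
Lemma davie_incr_tensor_shift h u m h' u' m' x :
  davie_incr h u m (x + davie_incr h' u' m' x) - davie_incr h u m x
  - davie_incr 0 0 (tensor u' u) x
  = h *: (V (x + davie_incr h' u' m' x) - V x)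
    + (\sum_k u 0 k *: (taylor_rest (F k) x (davie_incr h' u' m' x)
                       + 'd (F k) x (davie_incr h' 0 m' x))
    + \sum_j \sum_k m j k *: (field2 j k (x + davie_incr h' u' m' x) - field2 j k x)).
Proof.
rewrite davie_incr_tensor; set z := x + _.
have -> : \sum_k u 0 k *: (taylor_rest (F k) x (davie_incr h' u' m' x)
                       + 'd (F k) x (davie_incr h' 0 m' x))
   = \sum_k u 0 k *: F k z - \sum_k u 0 k *: F k x
     - \sum_k u 0 k *: 'd (F k) x (\sum_j u' 0 j *: F j x).
  rewrite -!sumrB; apply: eq_bigr => k _; rewrite -!scalerBr; congr (_ *: _).
  have -> : davie_incr h' u' m' x = davie_incr h' 0 m' x + \sum_j u' 0 j *: F j x.
    rewrite /davie_incr [\sum_i (0 : 'rV_l) 0 i *: _]big1 ?add0r; last first.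
      by move=> i _; rewrite mxE scale0r.
    vring R.
  rewrite /taylor_rest linearD /= -/z.
  have -> : F k (x + (davie_incr h' 0 m' x + \sum_j u' 0 j *: F j x)) = F k z.
    congr (F k _); rewrite /z /davie_incr [\sum_i (0 : 'rV_l) 0 i *: _]big1 ?add0r; last first.
      by move=> i _; rewrite mxE scale0r.
    vring R.
  vring R.
have -> : \sum_j \sum_k m j k *: (field2 j k z - field2 j k x)
   = \sum_j \sum_k m j k *: field2 j k z - \sum_j \sum_k m j k *: field2 j k x.
  rewrite -sumrB; apply: eq_bigr => j _; rewrite -sumrB.
  by apply: eq_bigr => k _; rewrite scalerBr.
rewrite /davie_incr -/z; vring R.
Qed.

Variable M : R.
Hypotheses (VM : C2_bound M V) (FM : forall i, C3_bound M (F i)).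

Lemma field_bound_ge0 : 0 <= M.
Proof. exact: C11_ge0 (C2_C11 VM). Qed.

Lemma field2_C11 j k : C11 (3 * M * M) (field2 j k).
Proof.
have [Fk Fk4] := FM k.
exact: (C11_apply (A := fun x => 'd (F k) x) (C2_dbdd Fk) (C2_dlip Fk) Fk4
  field_bound_ge0 (C2_C11 (C3_C2 (FM j)))).
Qed.

Let L : R := l%:R.

Lemma davie_incr_C11 (b1 b2 b3 : R) h u m : `|h| <= b1 -> `|u| <= b2 -> `|m| <= b3 ->
  C11 (b1 * M + (L * (b2 * M) + L * (L * (b3 * (3 * M * M))))) (davie_incr h u m).
Proof.
move=> h1 u2 m3; apply: C11_add; first exact: C11_scale h1 (C2_C11 VM).
have sumc (c : R) : L * c = \sum_(i < l) c by rewrite sumr_const card_ord mulr_natl.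
rewrite !sumc; apply: C11_add; apply: C11_sum => i.
  exact: C11_scale (le_trans (rV_norm_ge u i) u2) (C2_C11 (C3_C2 (FM i))).
apply: C11_sum => k.
exact: C11_scale (le_trans (mx_norm_ge m i k) m3) (field2_C11 i k).
Qed.

(** When a time step has length h, the size n of an increment is of order
    h^(1/p), that of its part n' without first level of order h^(2/p), and the
    sizes b1, b2, b3 of the coefficients of the other increment are of order
    h^(2/p), h^(1/p), h^(2/p): all terms are then of order h^(3/p). *)
Lemma davie_defect_bdd_lip (b1 b2 b3 n n' r : R) h u m h' u' m' :
  `|h| <= b1 -> `|u| <= b2 -> `|m| <= b3 ->
  C11 n (davie_incr h' u' m') -> bdd_lip n' (davie_incr h' 0 m') -> 3 + n <= r ->
  bdd_lip (b1 * (M * (n * r)) + (L * (b2 * (M * n ^+ 2 * (1 + r) + 2 * M * n'))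
           + L * (L * (b3 * (3 * M * M * (n * r))))))
    (fun x => davie_incr h u m (x + davie_incr h' u' m' x) - davie_incr h u m x
              - davie_incr 0 0 (tensor u' u) x).
Proof.
move=> h1 u2 m3 IC [I'b I'l] nr; have M0 := field_bound_ge0; have n0 := C11_ge0 IC.
have shift K f : C11 K f -> bdd_lip (K * (n * r)) (fun x => f (x + davie_incr h' u' m' x) - f x).
  move=> fC; have K0 := C11_ge0 fC; apply: (@bdd_lip_le _ _ (K * (n * (3 + n)))).
    by rewrite ler_wpM2l // ler_wpM2l.
  split; last exact: lip_shift (C11_four fC) (C11_bdd IC) (C11_lip IC).
  move=> x; apply: le_trans (C11_lip fC _ _) _; rewrite ler_wpM2l //.
  rewrite [X in `|X|](_ : _ = davie_incr h' u' m' x); last by vring R.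
  apply: le_trans (C11_bdd IC x) _; rewrite ler_peMr //; lra.
apply: (bdd_lip_ext (fun x => esym (davie_incr_tensor_shift h u m h' u' m' x))).
apply: bdd_lip_add; first exact: bdd_lip_scale h1 (shift _ _ (C2_C11 VM)).
rewrite /L -{1 2}(card_ord l); apply: bdd_lip_add; apply: bdd_lip_sum => i.
  apply: bdd_lip_scale (le_trans (rV_norm_ge u i) u2) _; apply: bdd_lip_add; last first.
    have [Fi Fi4] := FM i.
    have N'0 : 0 <= n' by apply: le_trans (I'b 0).
    split; last exact: (lip_apply (A := fun x => 'd (F i) x) (C2_dbdd Fi) (C2_dlip Fi) M0 I'b I'l).
    move=> x; apply: le_trans (C2_dbdd Fi _ _) _; rewrite (mulrC 2) -mulrA ler_wpM2l //.
    by apply: le_trans (I'b x) _; rewrite ler_peMl // ler1n.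
  split=> [x|x y].
    apply: le_trans (taylor_rest_le _ _ (C3_C2 (FM i))) _.
    rewrite -mulrA ler_wpM2l //; apply: le_trans (_ : n ^+ 2 <= _).
      by rewrite lerXn2r ?nnegrE // (C11_bdd IC).
    by rewrite ler_peMr ?sqr_ge0 //; lra.
  apply: le_trans (taylor_rest_lip _ _ _ _ (FM i)) _.
  rewrite -!mulrA ler_wpM2l //.
  have Nb z := C11_bdd IC z; have Nl := C11_lip IC x y.
  set Nx := davie_incr h' u' m' x in Nl *; set Ny := davie_incr h' u' m' y in Nl *.
  have Nx1 : `|Nx| <= n := Nb x. have Ny1 : `|Ny| <= n := Nb y.
  set d := `|x - y| in Nl *; have d0 : 0 <= d by rewrite /d.
  have nd0 : 0 <= n * d by rewrite mulr_ge0.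
  apply: le_trans (_ : n * (n * d) + n * (n * d + n * (2 * d + n * d)) <= _).
    apply: lerD; first by apply: ler_pM.
    apply: ler_pM => //; first by rewrite addr_ge0 // mulr_ge0 // addr_ge0 // mulr_ge0.
    apply: lerD => //; apply: ler_pM => //; first by rewrite addr_ge0 // mulr_ge0.
    by rewrite lerD2l.
  rewrite [leLHS](_ : _ = n ^+ 2 * ((4 + n) * d)); last by ring.
  by rewrite [leRHS]mulrA -expr2 ler_wpM2l ?sqr_ge0 // ler_wpM2r //; lra.
rewrite -{1}(card_ord l); apply: bdd_lip_sum => k.
exact: bdd_lip_scale (le_trans (mx_norm_ge m i k) m3) (shift _ _ (field2_C11 i k)).
Qed.

End Davie.

(** * Orders of magnitude *)

Lemma mx_norm_le (R : realType) (n m : nat) (A : 'M[R]_(n, m)) (c : R) :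
  0 <= c -> (forall j k, `|A j k| <= c) -> `|A| <= c.
Proof.
move=> c0 Ac; rewrite [leLHS]/Num.norm /= mx_normrE; apply/bigmax_leP.
by split=> // ij _; apply: Ac.
Qed.

(** All orders of magnitude are expressed with e = h^(1/p). The time h itself is
    of order e^2 because p >= 2. *)
Lemma holder_powers (R : realType) (p T h : R) : 2 <= p -> 0 <= h -> h <= T ->
  [/\ h `^ (2 / p) = (h `^ (1 / p)) ^+ 2, h `^ (3 / p) = (h `^ (1 / p)) ^+ 3,
      h <= T `^ (1 - 2 / p) * (h `^ (1 / p)) ^+ 2 & h `^ (1 / p) <= T `^ (1 / p)].
Proof.
move=> p2 h0 hT; have p0 : 0 < p by apply: lt_le_trans p2.
have E2 : h `^ (2 / p) = (h `^ (1 / p)) ^+ 2.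
  by rewrite -powR_mulrn ?powR_ge0 // -powRrM mul1r mulrC.
have E3 : h `^ (3 / p) = (h `^ (1 / p)) ^+ 3.
  by rewrite -powR_mulrn ?powR_ge0 // -powRrM mul1r mulrC.
have E1 : h <= T `^ (1 - 2 / p) * h `^ (2 / p).
  have [->|h1] := eqVneq h 0; first by rewrite mulr_ge0 ?powR_ge0.
  have hE : h = h `^ (1 - 2 / p) * h `^ (2 / p).
    by rewrite -powRD ?subrK ?powRr1 // h1 implybT.
  rewrite {1}hE ler_wpM2r ?powR_ge0 // powR_le //.
  by rewrite subr_ge0 ler_pdivrMr // mul1r.
split=> //; first by rewrite -E2.
by rewrite powR_le // divr_ge0 // ltW.
Qed.

Section RoughEquation.
Variables (R : realType) (E : completeNormedModType R) (l : nat).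
Variables (V : E -> E) (F : 'I_l -> E -> E) (M : R).
Hypotheses (VM : C2_bound M V) (FM : forall i, C3_bound M (F i)).
Implicit Types (x : E) (h e s t p T B C : R) (u : 'rV[R]_l) (m : 'M[R]_l) (X Y : rough_data R l).

Let L : R := l%:R.
Local Notation davie_incr := (davie_incr V F).
Local Notation davie := (davie V F).

(** With e = h^(1/p) <= th, and coefficients as in [small_coefs] below, the
    increment of the scheme is a first level part of size first_size B * e plus
    a part of size second_size B * e^2, so it has size incr_size B th * e; the
    defect has size defect_size B th * e^3. *)
Definition first_size B : R := L * (B * M).
Definition second_size B : R := B * M + L * (L * (B * (3 * M * M))).
Definition incr_size B (th : R) : R := first_size B + second_size B * th.
Definition defect_size B (th : R) : R :=
  let n := incr_size B th in let r := 3 + n * th in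
  B * M * n * r + L * B * (M * n ^+ 2 * (1 + r) + 2 * M * second_size B)
  + L * L * B * (3 * M * M * n * r).

Lemma first_size_ge0 B : 0 <= B -> 0 <= first_size B.
Proof. by move=> B0; rewrite !mulr_ge0 ?ler0n ?(field_bound_ge0 VM). Qed.

Lemma second_size_ge0 B : 0 <= B -> 0 <= second_size B.
Proof. by move=> B0; rewrite addr_ge0 // !mulr_ge0 ?ler0n ?(field_bound_ge0 VM). Qed.

Lemma incr_size_ge0 B th : 0 <= B -> 0 <= th -> 0 <= incr_size B th.
Proof.
move=> B0 th0; apply: addr_ge0; first exact: first_size_ge0.
by apply: mulr_ge0 th0; apply: second_size_ge0.
Qed.

Lemma defect_size_ge0 B th : 0 <= B -> 0 <= th -> 0 <= defect_size B th.
Proof.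
move=> B0 th0; have M0 := field_bound_ge0 VM; have L0 : 0 <= L by rewrite ler0n.
have n0 := incr_size_ge0 B0 th0; have s0 := second_size_ge0 B0.
have r0 : 0 <= 3 + incr_size B th * th by rewrite addr_ge0 // mulr_ge0.
have r1 : 0 <= 1 + (3 + incr_size B th * th) by rewrite addr_ge0.
rewrite /defect_size /=; set r := 3 + _ in r0 r1 *.
by rewrite !addr_ge0 ?mulr_ge0 ?sqr_ge0 // addr_ge0 ?mulr_ge0 ?sqr_ge0.
Qed.

(** The sizes of the coefficients of the field over a time step of length h,
    where e stands for h^(1/p). *)
Definition small_coefs B (e h : R) (u : 'rV[R]_l) (m : 'M[R]_l) : Prop :=
  [/\ `|h| <= B * e ^+ 2, `|u| <= B * e & `|m| <= B * e ^+ 2].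

Lemma incr_first B e h u m : small_coefs B e h u m ->
  C11 (first_size B * e) (fun x => \sum_i u 0 i *: F i x).
Proof.
move=> [_ u2 _].
have := davie_incr_C11 VM FM (b1 := 0) (b3 := 0) (h := 0) (m := 0) _ u2 _.
rewrite !normr0 => /(_ (lexx _) (lexx _)).
rewrite (_ : davie_incr 0 u 0 = fun x => \sum_i u 0 i *: F i x); last first.
  by apply/funext => x; rewrite davie_incr_first.
by rewrite !mul0r !mulr0 addr0 add0r -/L /first_size (_ : L * (B * e * M) = L * (B * M) * e); last by ring.
Qed.

Lemma incr_second B e h u m : small_coefs B e h u m ->
  C11 (second_size B * e ^+ 2) (davie_incr h 0 m).
Proof.
move=> [h2 _ m2].
have := davie_incr_C11 VM FM (b2 := 0) (u := 0) h2 _ m2.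
rewrite !normr0 => /(_ (lexx _)); rewrite mul0r mulr0 add0r -/L.
rewrite [X in C11 X _ -> _](_ : _ = second_size B * e ^+ 2) //.
by rewrite /second_size; ring.
Qed.

Lemma incr_C11 B th e h u m : 0 <= B -> 0 <= e -> e <= th -> small_coefs B e h u m ->
  C11 (incr_size B th * e) (davie_incr h u m).
Proof.
move=> B0 e0 eth [h2 u2 m2]; apply: C11_le (davie_incr_C11 VM FM h2 u2 m2).
rewrite -/L [leLHS](_ : _ = first_size B * e + second_size B * (e * e)); last first.
  by rewrite /first_size /second_size; ring.
rewrite /incr_size [leRHS]mulrDl lerD2l -[leRHS]mulrA ler_wpM2l ?second_size_ge0 //.
by rewrite ler_wpM2r.
Qed.

Lemma davie_defect B th e h u m h' u' m' : 0 <= B -> 0 <= e -> e <= th ->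
  small_coefs B e h u m -> small_coefs B e h' u' m' ->
  bdd_lip (defect_size B th * e ^+ 3)
    (fun x => davie_incr h u m (x + davie_incr h' u' m' x) - davie_incr h u m x
              - davie_incr 0 0 (tensor u' u) x).
Proof.
move=> B0 e0 eth [h2 u2 m2] H'.
have th0 := le_trans e0 eth; have n0 := incr_size_ge0 B0 th0.
have I1 := incr_C11 B0 e0 eth H'.
have I2 := C11_bdd_lip (incr_second H').
have nr : 3 + incr_size B th * e <= 3 + incr_size B th * th by rewrite lerD2l ler_wpM2l.
apply: bdd_lip_le (davie_defect_bdd_lip VM FM h2 u2 m2 I1 I2 nr).
by rewrite le_eqVlt; apply/orP; left; apply/eqP; rewrite /defect_size -/L; ring.
Qed.

End RoughEquation.

(** * The Davie scheme along a rough path *)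

Section RoughFlow.
Variables (R : realType) (E : completeNormedModType R) (l : nat).
Variables (V : E -> E) (F : 'I_l -> E -> E) (M : R).
Hypotheses (VM : C2_bound M V) (FM : forall i, C3_bound M (F i)).
Implicit Types (x : E) (h e s t u p T B C : R) (m : 'M[R]_l) (X Y : rough_data R l).

Let L : R := l%:R.
Local Notation davie_incr := (davie_incr V F).
Local Notation davie := (davie V F).

Definition holder_le p T C X : Prop := forall s t : R, 0 <= s -> s <= t -> t <= T ->
  `|rp1 X t s| <= C * (t - s) `^ (1 / p) /\ `|rp2 X t s| <= C * (t - s) `^ (2 / p).

(** The sizes over [s', t'] are measured with the length of a larger interval
    [s, t], which is the one that appears in the estimate of the defect. *)
Lemma holder_small_coefs p T C X s t s' t' : 2 <= p -> 0 <= C -> holder_le p T C X ->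
  0 <= s -> s <= s' -> s' <= t' -> t' <= t -> t <= T ->
  small_coefs (C + T `^ (1 - 2 / p)) ((t - s) `^ (1 / p)) (t' - s') (rp1 X t' s') (rp2 X t' s').
Proof.
move=> p2 C0 XC s0 ss' st' tt' tT.
have h0' : 0 <= t' - s' by rewrite subr_ge0.
have hh : t' - s' <= t - s by apply: lerB.
have hT : t - s <= T by rewrite lerBlDr ler_wpDr.
have [E2 _ E1 _] := holder_powers p2 h0' (le_trans hh hT).
have p0 : 0 <= 1 / p by rewrite divr_ge0 // (le_trans _ p2).
have ee := powR_le p0 h0' hh.
have e0 := powR_ge0 (t' - s') (1 / p).
set e := (t - s) `^ (1 / p) in ee *; set e' := (t' - s') `^ (1 / p) in E1 E2 ee e0.
have ee2 : e' ^+ 2 <= e ^+ 2 by rewrite lerXn2r ?nnegrE // (le_trans e0).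
have Th0 : 0 <= T `^ (1 - 2 / p) by apply: powR_ge0.
have [] := XC s' t' (le_trans s0 ss') st' (le_trans tt' tT); rewrite -/e' E2 => X1 X2.
split.
- rewrite ger0_norm //; apply: le_trans E1 _.
  by apply: ler_pM ee2; rewrite ?sqr_ge0 // lerDr.
- by apply: le_trans X1 _; apply: ler_pM ee; rewrite // lerDl.
- by apply: le_trans X2 _; apply: ler_pM ee2; rewrite ?sqr_ge0 // lerDl.
Qed.

(** By Chen's relation the Davie map over [s, t] is x + I_tu(x) + I_us(x) plus
    the tensor term which the shift of I_tu by I_us produces to second order. *)
Lemma davie_defectE p T X s u t x : rough_path p T X ->
  0 <= s -> s <= u -> u <= t -> t <= T ->
  davie X t u (davie X u s x) - davie X t s x
  = davie_incr (t - u) (rp1 X t u) (rp2 X t u)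
      (x + davie_incr (u - s) (rp1 X u s) (rp2 X u s) x)
    - davie_incr (t - u) (rp1 X t u) (rp2 X t u) x
    - davie_incr 0 0 (tensor (rp1 X u s) (rp1 X t u)) x.
Proof.
move=> [chen1 chen2 _] s0 su ut tT.
rewrite /davie (chen1 s u t) // (chen2 s u t) //.
have -> : t - s = t - u + 0 + (u - s) by ring.
have -> : rp1 X t u + rp1 X u s = rp1 X t u + 0 + rp1 X u s by rewrite addr0.
rewrite !davie_incrD.
vring R.
Qed.

Lemma davie_almost_flow p T C : 2 <= p -> 0 <= C -> exists2 c : R, 0 <= c &
  forall X, rough_path p T X -> holder_le p T C X ->
    almost_flow T (3 / p) (1 / p) c (davie X).
Proof.
move=> p2 C0; have p0 : 0 < p by apply: lt_le_trans p2.
pose B : R := C + T `^ (1 - 2 / p); pose th : R := T `^ (1 / p).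
have B0 : 0 <= B by rewrite addr_ge0 // powR_ge0.
have th0 : 0 <= th by apply: powR_ge0.
pose c1 := incr_size l M B th; pose c2 := defect_size l M B th.
have c10 : 0 <= c1 by apply: (incr_size_ge0 l VM B0 th0).
have c20 : 0 <= c2 by apply: (defect_size_ge0 l VM B0 th0).
exists (c1 + c2); first exact: addr_ge0.
move=> X Xp XC.
have eth s t : 0 <= s -> s <= t -> t <= T -> (t - s) `^ (1 / p) <= th.
  move=> s0 st tT; apply: powR_le; rewrite ?subr_ge0 //; first by rewrite divr_ge0 // ltW.
  by rewrite lerBlDr ler_wpDr.
have incr s t : 0 <= s -> s <= t -> t <= T ->
    C11 ((c1 + c2) * (t - s) `^ (1 / p)) (fun x => davie X t s x - x).
  move=> s0 st tT.
  have H := holder_small_coefs p2 C0 XC s0 (lexx s) st (lexx t) tT.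
  have := incr_C11 VM FM B0 (powR_ge0 _ _) (eth s t s0 st tT) H.
  rewrite (_ : (fun x => _) = davie_incr (t - s) (rp1 X t s) (rp2 X t s)); last first.
    by apply/funext => x; rewrite /davie; vring R.
  by apply: C11_le; rewrite ler_wpM2r ?powR_ge0 // lerDl.
have defect s u t : 0 <= s -> s <= u -> u <= t -> t <= T ->
    bdd_lip ((c1 + c2) * (t - s) `^ (3 / p)) (fun x => davie X t u (davie X u s x) - davie X t s x).
  move=> s0 su ut tT; have st := le_trans su ut.
  have h0 : 0 <= t - s by rewrite subr_ge0.
  have hT : t - s <= T by rewrite lerBlDr ler_wpDr.
  have [_ E3 _ _] := holder_powers p2 h0 hT.
  have H := holder_small_coefs p2 C0 XC s0 su ut (lexx t) tT.
  have H' := holder_small_coefs p2 C0 XC s0 (lexx s) su ut tT.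
  apply: (bdd_lip_ext (fun x => esym (davie_defectE x Xp s0 su ut tT))).
  apply: bdd_lip_le (davie_defect VM FM B0 (powR_ge0 _ _) (eth s t s0 st tT) H H').
  by rewrite E3 ler_wpM2r ?exprn_ge0 ?powR_ge0 // lerDr.
split=> [s x s0 sT|s t s0 st tT|s t s0 st tT|s u t x s0 su ut tT|s u t s0 su ut tT].
- apply/eqP; rewrite -subr_eq0 -normr_le0.
  have := C11_bdd (incr s s s0 (lexx s) sT) x.
  by rewrite subrr powR0 ?mulr0 // mul1r gt_eqF // invr_gt0.
- exact: C11_lip (incr s t s0 st tT).
- exact: C11_four (incr s t s0 st tT).
- exact: (proj1 (defect s u t s0 su ut tT)).
- exact: (proj2 (defect s u t s0 su ut tT)).
Qed.

Definition antisym_half m : 'M[R]_l := 2^-1 *: (m - m^T).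

Lemma antisym_half_le m : `|antisym_half m| <= `|m|.
Proof.
apply: mx_norm_le => // j k; rewrite !mxE normrM ger0_norm ?invr_ge0 //.
have := ler_normB (m j k) (m k j).
by have := mx_norm_ge m j k; have := mx_norm_ge m k j; lra.
Qed.

Lemma weak_geometric_split T X s t : weak_geometric T X -> 0 <= s -> s <= t -> t <= T ->
  rp2 X t s = antisym_half (rp2 X t s) + 2^-1 *: tensor (rp1 X t s) (rp1 X t s).
Proof.
move=> wg s0 st tT; rewrite -wg // /antisym_half -scalerDr.
rewrite (_ : _ - _ + _ = rp2 X t s + rp2 X t s); last by vring R.
by rewrite scalerDr -scalerDl -[LHS]scale1r; congr (_ *: _); field.
Qed.

(** The bracket being antisymmetric in (j, k), the field of the equation is
    a Davie increment whose second level is antisymmetric. *)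
Lemma rde_fieldE X t s x : rde_field V F X t s x
  = davie_incr 0 (rp1 X t s) 0 x + davie_incr (t - s) 0 (antisym_half (rp2 X t s)) x.
Proof.
rewrite -davie_incrD add0r addr0 add0r /rde_field /davie_incr; congr (_ + (_ + _)).
set m := rp2 X t s.
have -> : \sum_j \sum_k m j k *: lie_bracket (F j) (F k) x =
    \sum_j \sum_k m j k *: field2 F j k x - \sum_j \sum_k m^T j k *: field2 F j k x.
  rewrite [X in _ - X]exchange_big -sumrB; apply: eq_bigr => j _; rewrite -sumrB.
  by apply: eq_bigr => k _; rewrite lie_bracketE scalerBr mxE.
rewrite -sumrB scaler_sumr; apply: eq_bigr => j _; rewrite -sumrB scaler_sumr.
by apply: eq_bigr => k _; rewrite -scalerBl scalerA !mxE.
Qed.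

Lemma rde_field_C11 X t s : exists K : R, C11 K (rde_field V F X t s).
Proof.
have := davie_incr_C11 VM FM (lexx `|t - s|) (lexx `|rp1 X t s|)
  (lexx `|antisym_half (rp2 X t s)|).
rewrite (_ : davie_incr _ _ _ = rde_field V F X t s); first by eexists; eassumption.
by apply/funext => x; rewrite rde_fieldE -davie_incrD add0r addr0 add0r.
Qed.

(** The second order term of the Taylor expansion of the differential equation is
    the Davie increment of half the tensor square of the first level, which is
    the symmetric part missing from the field by [rde_fieldE]. *)
Lemma rde_field_davie p T C : 2 <= p -> 0 <= C -> exists2 c : R, 0 <= c &
  forall X, holder_le p T C X -> weak_geometric T X ->
    forall s t x y, 0 <= s -> s <= t -> t <= T ->
      ode_solution (rde_field V F X t s) x y ->
      `|y 1 - davie X t s x| <= c * (t - s) `^ (3 / p).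
Proof.
move=> p2 C0; have p0 : 0 < p by apply: lt_le_trans p2.
pose B : R := C + T `^ (1 - 2 / p); pose th : R := T `^ (1 / p).
have B0 : 0 <= B by rewrite addr_ge0 // powR_ge0.
have th0 : 0 <= th by apply: powR_ge0.
pose q0 := first_size l M B; pose q1 := second_size l M B; pose c1 := incr_size l M B th.
have q00 : 0 <= q0 by apply: (first_size_ge0 l VM B0).
have q10 : 0 <= q1 by apply: (second_size_ge0 l VM B0).
have c10 : 0 <= c1 by apply: (incr_size_ge0 l VM B0 th0).
exists (q0 * c1 ^+ 2 + q0 * (q0 * c1 + q1) + q1 * c1).
  by apply: addr_ge0 (mulr_ge0 q10 c10); apply: addr_ge0;
    apply: mulr_ge0 => //; [apply: sqr_ge0 | apply: addr_ge0 => //; apply: mulr_ge0].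
move=> X XC wg s t x y s0 st tT ysol.
have h0 : 0 <= t - s by rewrite subr_ge0.
have hT : t - s <= T by rewrite lerBlDr ler_wpDr.
have [_ E3 _ eth] := holder_powers p2 h0 hT.
have := holder_small_coefs p2 C0 XC s0 (lexx s) st (lexx t) tT.
have := powR_ge0 (t - s) (1 / p); rewrite E3 -/B.
move: eth; rewrite -/th; set e := _ `^ _ => eth e0 H.
set u := rp1 X t s in H *; set m := rp2 X t s in H *; pose m' := antisym_half m.
have H' : small_coefs B e (t - s) u m'.
  by have [? ? m2] := H; split=> //; apply: le_trans (antisym_half_le _) m2.
have GC := incr_first VM FM H'; have KC := incr_second VM FM H'.
rewrite -/q0 in GC; rewrite -/q1 in KC.
pose G x : E := \sum_i u 0 i *: F i x.
pose DG x v : E := \sum_i u 0 i *: 'd (F i) x v.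
have M0 := field_bound_ge0 VM.
have bsum (f : 'I_l -> E) (a : R) : (forall i, `|f i| <= a) -> `|\sum_i u 0 i *: f i| <= L * (B * e * a).
  move=> fa; apply: le_trans (ler_norm_sum _ _ _) _.
  have -> : L * (B * e * a) = \sum_(i < l) (B * e * a) by rewrite sumr_const card_ord mulr_natl.
  apply: ler_sum => i _; apply: normZ_le (fa i).
  by have [_ u2 _] := H; apply: le_trans (rV_norm_ge u i) u2.
have sizeE a : L * (B * e * (M * a)) = q0 * e * a by rewrite /q0 /first_size -/L; ring.
have DGb z v : `|DG z v| <= q0 * e * `|v|.
  by rewrite -sizeE; apply: bsum => i; apply: C2_dbdd (C3_C2 (FM i)) _ _.
have DGl z v w (r : R) : DG z (v - r *: w) = DG z v - r *: DG z w.
  rewrite /DG scaler_sumr -sumrB; apply: eq_bigr => i _.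
  by rewrite linearB linearZ /= scalerBr scalerA mulrC -scalerA.
have DGt z v : `|G (z + v) - G z - DG z v| <= q0 * e * `|v| ^+ 2.
  rewrite -sizeE /G /DG -!sumrB.
  rewrite (eq_bigr (fun i => u 0 i *: taylor_rest (F i) z v)); last first.
    by move=> i _; rewrite -!scalerBr.
  by apply: bsum => i; apply: taylor_rest_le (C3_C2 (FM i)).
have fieldE : rde_field V F X t s = fun z => G z + davie_incr (t - s) 0 m' z.
  by apply/funext => z; rewrite rde_fieldE davie_incr_first.
rewrite fieldE in ysol.
have q0e : 0 <= q0 * e by rewrite mulr_ge0.
have q1e : 0 <= q1 * e ^+ 2 by rewrite mulr_ge0 // sqr_ge0.
have := ode_solution_expansion q0e q1e (C11_bdd GC) (C11_lip GC) (C11_bdd KC) (C11_lip KC)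
  DGb DGl DGt ysol.
have -> : x + \sum_i u 0 i *: F i x + davie_incr (t - s) 0 m' x + 2^-1 *: DG x (\sum_i u 0 i *: F i x)
    = davie X t s x.
  rewrite /davie (weak_geometric_split wg s0 st tT) -/m -/m' -/u.
  rewrite /DG -(davie_incr_tensor V F u u x) -davie_incrZ -(davie_incr_first V F u x) mulr0 scaler0.
  set k := _ *: tensor u u.
  have -> : davie_incr (t - s) u (m' + k) x
      = davie_incr 0 u 0 x + (davie_incr (t - s) 0 m' x + davie_incr 0 0 k x).
    by rewrite -!davie_incrD !add0r !addr0.
  vring R.
move/le_trans; apply.
have nk : q0 * e + q1 * e ^+ 2 <= c1 * e.
  rewrite /c1 /incr_size -/q0 -/q1 [leRHS]mulrDl lerD2l -[leRHS]mulrA expr2 ler_wpM2l // ler_wpM2r //.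
have nk0 : 0 <= q0 * e + q1 * e ^+ 2 by rewrite addr_ge0.
apply: le_trans (_ : q0 * e * (c1 * e) ^+ 2 + q0 * e * (q0 * e * (c1 * e) + q1 * e ^+ 2)
  + q1 * e ^+ 2 * (c1 * e) <= _); last first.
  by rewrite le_eqVlt; apply/orP; left; apply/eqP; ring.
rewrite !lerD ?ler_wpM2l //; last by rewrite lerD2r ler_wpM2l.
by rewrite lerXn2r ?nnegrE // mulr_ge0.
Qed.

Lemma davie_dist T p X Y r : 2 <= p -> 0 <= r ->
  (forall s t, 0 <= s -> s <= t -> t <= T ->
     `|rp1 X t s - rp1 Y t s| <= r * (t - s) `^ (1 / p) /\
     `|rp2 X t s - rp2 Y t s| <= r * (t - s) `^ (2 / p)) ->
  forall s t x, 0 <= s -> s <= t -> t <= T ->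
    `|davie X t s x - davie Y t s x| <= r * (incr_size l M 1 (T `^ (1 / p)) * T `^ (1 / p)).
Proof.
move=> p2 r0 XY s t x s0 st tT.
have h0 : 0 <= t - s by rewrite subr_ge0.
have hT : t - s <= T by rewrite lerBlDr ler_wpDr.
have [E2 _ _ eth] := holder_powers p2 h0 hT.
have := powR_ge0 (t - s) (1 / p).
have [] := XY s t s0 st tT; rewrite E2; move: eth.
set e := (t - s) `^ _; set th := T `^ _ => eth X1 X2 e0.
have -> : davie X t s x - davie Y t s x =
    davie_incr 0 (rp1 X t s - rp1 Y t s) (rp2 X t s - rp2 Y t s) x.
  have -> : davie_incr 0 (rp1 X t s - rp1 Y t s) (rp2 X t s - rp2 Y t s) x
      = davie_incr (t - s - (t - s)) (rp1 X t s - rp1 Y t s) (rp2 X t s - rp2 Y t s) x.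
    by rewrite subrr.
  rewrite /davie !davie_incrD.
  have -> : davie_incr (- (t - s)) (- rp1 Y t s) (- rp2 Y t s) x
      = - davie_incr (t - s) (rp1 Y t s) (rp2 Y t s) x.
    by rewrite -[RHS]scaleN1r -davie_incrZ !scaleN1r mulN1r.
  vring R.
have H : small_coefs r e 0 (rp1 X t s - rp1 Y t s) (rp2 X t s - rp2 Y t s).
  by split=> //; rewrite normr0 mulr_ge0 // sqr_ge0.
apply: le_trans (C11_bdd (incr_C11 VM FM r0 e0 eth H) x) _.
have -> : incr_size l M r th = r * incr_size l M 1 th.
  by rewrite /incr_size /first_size /second_size; ring.
rewrite -mulrA ler_wpM2l // ler_wpM2l //.
exact: (incr_size_ge0 l VM ler01 (powR_ge0 _ _)).
Qed.

End RoughFlow.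

(** * Rough differential equations on flows *)

Lemma lip_continuous (R : realType) (E : normedModType R) (L : R) (f : E -> E) :
  lip L f -> continuous f.
Proof.
move=> fL x; apply/cvgrPdist_le => e e0.
apply/nbhs_ballP; exists (e / (`|L| + 1)) => /= [|y].
  by rewrite divr_gt0 // ltr_wpDl.
rewrite -ball_normE /= => /ltW; rewrite ler_pdivlMr ?ltr_wpDl // => xy.
apply: le_trans (fL x y) (le_trans _ xy); rewrite mulrC ler_wpM2l //.
by rewrite (le_trans (ler_norm L)) // lerDl.
Qed.

Lemma lip_lipschitz (R : realType) (E : normedModType R) (L K : R) (f : E -> E) :
  L <= K -> lip L f -> K.-lipschitz f.
Proof. by move=> LK fL [x y] _ /=; apply: le_trans (fL x y) _; rewrite ler_wpM2r. Qed.

Section RoughDist.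
Variables (R : realType) (l : nat) (p T r : R) (X Y : rough_data R l).

Lemma rough_dist_lt : (rough_dist p T X Y < r%:E)%E -> forall s t,
  0 <= s -> s < t -> t <= T ->
  `|rp1 X t s - rp1 Y t s| <= r * (t - s) `^ (1 / p) /\
  `|rp2 X t s - rp2 Y t s| <= r * (t - s) `^ (2 / p).
Proof.
rewrite /rough_dist gt_max => /andP[H1 H2] s t s0 st tT.
have ts : 0 < t - s by rewrite subr_gt0.
have mem : [set st : R * R | [/\ 0 <= st.1, st.1 < st.2 & st.2 <= T]] (s, t) by split.
split.
- rewrite -ler_pdivrMr ?powR_gt0 // -lee_fin.
  apply: le_trans (ltW H1); apply: ereal_sup_ubound; exists (s, t) => //.
- rewrite -ler_pdivrMr ?powR_gt0 // -lee_fin.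
  apply: le_trans (ltW H2); apply: ereal_sup_ubound; exists (s, t) => //.
Qed.

End RoughDist.

Lemma common_field_bound (R : realType) (E : completeNormedModType R) (V : E -> E)
    (l : nat) (F : 'I_l -> E -> E) : Ckb 2 V -> (forall i, Ckb 3 (F i)) ->
  exists M : R, C2_bound M V /\ forall i, C3_bound M (F i).
Proof.
move=> hV hF; have [MV VM] := Ckb_C2_bound (leqnn 2) hV.
have /choice[m Hm] := fun i => Ckb_C3_bound (hF i).
have mM i : m i <= \sum_i `|m i|.
  apply: le_trans (ler_norm _) _; rewrite (bigD1 i) //= lerDl; exact: sumr_ge0.
exists (`|MV| + \sum_i `|m i|); split=> [|i].
  by apply: C2_bound_le VM; rewrite (le_trans (ler_norm MV)) // lerDl sumr_ge0.
by apply: C3_bound_le (Hm i); apply: le_trans (mM i) _; rewrite lerDr.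
Qed.

Theorem theorem16 (R : realType) (p T : R) (hp2 : 2 <= p) (hp3 : p < 3)
    (hT : 0 < T) (E : completeNormedModType R) (V : E -> E) (hV : Ckb 2 V)
    (l : nat) (F : 'I_l -> E -> E) (hF : forall i : 'I_l, Ckb 3 (F i)) :
  exists a : R, 1 < a /\
  exists Phi : rough_data R l -> R -> R -> E -> E,
    (forall X : rough_data R l, rough_path p T X -> weak_geometric T X ->
       [/\ solution_flow T V F a X (Phi X),
           (forall (b : R) (psi : R -> R -> E -> E), 1 < b ->
              solution_flow T V F b X psi ->
              forall s t : R, 0 <= s -> s <= t -> t <= T ->
                psi t s = Phi X t s) &
           uniformly_lipschitz_homeo T (Phi X)]) /\
    (forall X : rough_data R l, rough_path p T X -> weak_geometric T X ->
       forall eps : R, 0 < eps -> exists2 eta : R, 0 < eta &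
         forall Y : rough_data R l, rough_path p T Y -> weak_geometric T Y ->
           (rough_dist p T X Y < eta%:E)%E ->
           (flow_dist T (Phi X) (Phi Y) < eps%:E)%E).
Proof.
have [M [VM FM]] := common_field_bound hV hF.
have p0 : 0 < p by apply: lt_le_trans hp2.
have a1 : 1 < 3 / p by rewrite ltr_pdivlMr // mul1r.
have g0 : 0 < 1 / p by rewrite divr_gt0.
exists (3 / p); split=> //; exists (fun X => sewn (davie V F X)).
have holder (X : rough_data R l) : rough_path p T X -> exists2 C, 0 <= C & holder_le p T C X.
  move=> [_ _ [C HC]]; exists `|C| => // s t s0 st tT; have [H1 H2] := HC s t s0 st tT.
  split; [apply: le_trans H1 _|apply: le_trans H2 _];
    by rewrite ler_wpM2r ?powR_ge0 ?ler_norm.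
split=> [X Xp wg|X Xp wg eps eps0]; have [C C0 XC] := holder X Xp.
  have [c c0 af] := davie_almost_flow VM FM T hp2 C0.
  have {af}Xaf := af X Xp XC.
  have [c' c'0 Hmu] := rde_field_davie VM FM T hp2 C0.
  have {}Hmu := Hmu X XC wg.
  have mu_davie (mu : E -> E) s t : 0 <= s -> s <= t -> t <= T ->
      time1_map (rde_field V F X t s) mu ->
      forall x, `|mu x - davie V F X t s x| <= c' * (t - s) `^ (3 / p).
    move=> s0 st tT Hm x; have [/(_ erefl)[y [ysol <-]] _] := Hm x (mu x).
    exact: Hmu.
  have flow := sewn_is_flow hT a1 g0 c0 Xaf.
  have [D [d [D0 d0 near]]] := @sewn_near _ E _ _ _ _ hT a1 g0 c0.
  split.
  - split=> //; exists (fun t s => sewn (euler (rde_field V F X t s)) 1 0).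
    have mu1 s t : time1_map (rde_field V F X t s) (sewn (euler (rde_field V F X t s)) 1 0).
      by have [K WK] := rde_field_C11 VM FM X t s; apply: time1_map_euler WK.
    split=> // ; exists d, (D + c' + 1); split=> //; first by rewrite ltr_wpDl // addr_ge0.
    move=> s t s0 st tT ts x.
    have [H1 _] := near _ Xaf s t s0 st tT ts.
    have := mu_davie _ s t s0 st tT (mu1 s t) x; rewrite distrC => H2.
    apply: le_trans (norm_triangle (H1 x) H2) _; rewrite -mulrDl ler_wpM2r ?powR_ge0 //.
    by rewrite lerDl.
  (* the trajectories of another solution flow follow the Davie scheme up to
     o(h), as b > 1 *)
  - move=> b psi b1 [[psi_id psi_comp] [mu [mu1 [d' [k [d'0 k0 Hk]]]]]] s t s0 st tT.
    apply/funext => x.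
    rewrite (sewn_track (y := fun u => psi u s x) hT a1 g0 c0 Xaf s0 st tT); last first.
      move=> e e0; have e20 : 0 < e / 2 by rewrite divr_gt0.
      have [d1 d10 H1] := powR_super (ltW k0) b1 e20.
      have [d2 d20 H2] := powR_super c'0 a1 e20.
      exists (Num.min d' (Num.min d1 d2)) => [|u v su uv vt]; first by rewrite !lt_min d'0 d10.
      rewrite !le_min => /and3P[ud' ud1 ud2].
      have u0 := le_trans s0 su; have vT := le_trans vt tT.
      rewrite (psi_comp s u v) //=; set z := psi u s x.
      have h0 : 0 <= v - u by rewrite subr_ge0.
      apply: le_trans (norm_triangle (Hk u v u0 uv vT ud' z)
        (mu_davie _ u v u0 uv vT (mu1 u v u0 uv vT) z)) _.
      apply: le_trans (lerD (H1 _ h0 ud1) (H2 _ h0 ud2)) _.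
      by rewrite -mulrDl -splitr.
    by rewrite psi_id // (le_trans st).
  have [L1 L10 HL1] := @sewn_lip _ E _ _ _ _ hT a1 g0 c0.
  have [L2 L20 HL2] := @sewn_inverse _ E _ _ _ _ hT a1 g0 c0.
  exists (L1 + L2) => s t s0 st tT.
  have [psi [K1 K2] psiL] := HL2 _ Xaf s t s0 st tT.
  have phiL := HL1 _ Xaf s t s0 st tT.
  exists psi; split=> //; [exact: lip_continuous phiL|exact: lip_continuous psiL|].
  by split; [apply: lip_lipschitz phiL; rewrite lerDl|apply: lip_lipschitz psiL; rewrite lerDr].
(* both X and the rough paths at distance less than 1 from X satisfy the Hoelder
   bounds with constant C + 1, hence share the constants of the sewing *)
have C10 : 0 <= C + 1 by rewrite addr_ge0.
have [c c0 af] := davie_almost_flow VM FM T hp2 C10.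
have eps20 : 0 < eps / 2 by rewrite divr_gt0.
have [r r0 Hr] := @sewn_continuous _ E _ _ _ _ _ hT a1 g0 c0 eps20.
pose K : R := incr_size l M 1 (T `^ (1 / p)) * T `^ (1 / p).
have K0 : 0 <= K.
  by rewrite mulr_ge0 ?powR_ge0 //; apply: (incr_size_ge0 l VM ler01); apply: powR_ge0.
have K1 : 0 < K + 1 by rewrite ltr_wpDl.
exists (Num.min 1 (r / (K + 1))) => [|Y Yp Ywg]; first by rewrite lt_min ltr01 divr_gt0.
set eta := Num.min _ _ => XYd.
have eta0 : 0 <= eta by rewrite le_min ler01 divr_ge0 // ltW.
have eta1 : eta <= 1 by rewrite ge_min lexx.
have etaK : eta * K <= r.
  have : eta <= r / (K + 1) by rewrite ge_min lexx orbT.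
  by rewrite ler_pdivlMr // => /(le_trans _) -> //; rewrite ler_wpM2l // lerDl.
have XY s t : 0 <= s -> s <= t -> t <= T ->
    `|rp1 X t s - rp1 Y t s| <= eta * (t - s) `^ (1 / p) /\
    `|rp2 X t s - rp2 Y t s| <= eta * (t - s) `^ (2 / p).
  move=> s0; rewrite le_eqVlt => /orP[/eqP <- sT|st tT]; last exact: rough_dist_lt XYd s t s0 st tT.
  have [C' _ YC] := holder Y Yp.
  have p1 : 1 / p != 0 by rewrite gt_eqF.
  have p2 : 2 / p != 0 by rewrite gt_eqF // divr_gt0.
  have rp0 (Z : rough_data R l) D : holder_le p T D Z -> rp1 Z s s = 0 /\ rp2 Z s s = 0.
    move=> /(_ s s s0 (lexx s) sT); rewrite subrr !powR0 // mulr0.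
    by rewrite !normr_le0 => -[/eqP -> /eqP ->].
  have [-> ->] := rp0 X C XC; have [-> ->] := rp0 Y C' YC.
  by rewrite !subrr !normr0 !mulr_ge0 ?powR_ge0.
have XC1 : holder_le p T (C + 1) X.
  move=> s t s0 st tT; have [H1 H2] := XC s t s0 st tT.
  by split; [apply: le_trans H1 _|apply: le_trans H2 _]; rewrite ler_wpM2r ?powR_ge0 ?lerDl.
have YC1 : holder_le p T (C + 1) Y.
  move=> s t s0 st tT; have [H1 H2] := XC s t s0 st tT; have [D1 D2] := XY s t s0 st tT.
  have le1 (q : R) : eta * (t - s) `^ q <= 1 * (t - s) `^ q by rewrite ler_wpM2r ?powR_ge0.
  rewrite distrC in D1; rewrite distrC in D2; rewrite (addrC C).
  split; rewrite [leRHS]mulrDl.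
    exact: (normD_le (esym (subrK _ _)) (le_trans D1 (le1 _)) H1).
  exact: (normD_le (esym (subrK _ _)) (le_trans D2 (le1 _)) H2).
apply: le_lt_trans (_ : (eps / 2)%:E < _)%E; last first.
  by rewrite lte_fin ltr_pdivrMr // ltr_pMr // ltr1n.
apply: ge_ereal_sup => _ [s [t [x [s0 st tT ->]]]]; rewrite lee_fin.
apply: (Hr _ _ (af X Xp XC1) (af Y Yp YC1)) => // s' t' x' s'0 st' t'T.
apply: le_trans (davie_dist VM FM hp2 eta0 XY x' s'0 st' t'T) etaK.
Qed.
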